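(* Suppose that there exist $2^{\mathfrak c}$ pairwise Rudin–Keisler incomparable selective ultrafilters on $\omega$. Let $\kappa$ be an infinite cardinal with $\kappa\le 2^{\mathfrak c}$. Then there exists a Hausdorff topological group $G$ such that $G^{\kappa}$ is countably pracompact and $G^{\kappa^+}$ is not countably pracompact.
   Context: $\kappa^+$ is the successor cardinal of $\kappa$. A space $X$ is countably pracompact if there is a dense set $D\subseteq X$ such that every infinite subset of $D$ has an accumulation point in $X$. Selective ultrafilter: a free ultrafilter $p$ on $\omega$ such that for every partition $\{A_n\}$ of $\omega$ either some $A_n\in p$ or some $B\in p$ meets each $A_n$ in exactly one point. Rudin–Keisler: $p\le_{RK}q$ iff $p=\{A:f^{-1}(A)\in q\}$ for some $f:\omega\to\omega$; incomparable means neither $p\le_{RK}q$ nor $q\le_{RK}p$. Powers carry the product topology. *)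

(* Defs.v *)
From HB Require Import structures.
From mathcomp Require Import all_boot all_order all_algebra.
From mathcomp Require Import all_classical all_reals all_analysis.
Set Implicit Arguments. Unset Strict Implicit. Unset Printing Implicit Defensive.
Local Open Scope classical_set_scope.
Local Open Scope card_scope.

Definition is_ultrafilter (p : set (set nat)) : Prop :=
  [/\ p setT, ~ p set0,
      (forall A B, p A -> A `<=` B -> p B),
      (forall A B, p A -> p B -> p (A `&` B)) &
      (forall A, p A \/ p (~` A))].

Definition free_filter (p : set (set nat)) : Prop :=
  forall n : nat, exists A, p A /\ ~ A n.

Definition nat_partition (A : nat -> set nat) : Prop :=
  [/\ (forall n, A n !=set0),
      (forall m n, m <> n -> A m `&` A n = set0) &
      (forall x, exists n, A n x)].

Definition selective (p : set (set nat)) : Prop :=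
  [/\ is_ultrafilter p, free_filter p &
      forall A : nat -> set nat, nat_partition A ->
        (exists n, p (A n)) \/
        (exists B, p B /\ forall n, exists! x, B x /\ A n x)].

Definition RK_le (p q : set (set nat)) : Prop :=
  exists f : nat -> nat, p = [set A | q (f @^-1` A)].

Definition RK_incomparable (p q : set (set nat)) : Prop :=
  ~ RK_le p q /\ ~ RK_le q p.

Definition topological_group (G : topologicalType)
    (mul : G -> G -> G) (inv : G -> G) (e : G) : Prop :=
  [/\ (forall x y z, mul x (mul y z) = mul (mul x y) z),
      (forall x, mul e x = x),
      (forall x, mul (inv x) x = e),
      continuous (fun xy : G * G => mul xy.1 xy.2) &
      continuous inv].

Definition countably_pracompact (X : topologicalType) : Prop :=
  exists D : set X, dense D /\
    forall A : set X, A `<=` D -> infinite_set A -> exists x, limit_point A x.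

Definition is_successor_card (K K' : Type) : Prop :=
  [set: K] #<= [set: K'] /\ ~ ([set: K'] #<= [set: K]) /\
  forall L : Type, [set: K] #<= [set: L] -> ~ ([set: L] #<= [set: K]) ->
    [set: K'] #<= [set: L].

(* Main.v *)
(* Let M be a set of size 2^c. Inside the compact Boolean group 2^M take, for each i in K, a dense set
   X_i, of size 2^c, chosen so generically that every countable set of points of X = \bigcup_i X_i is
   as free as possible: all 0/1 assignments on it are realized by coordinates. Let the m-th sequence
   of almost constant points of \prod_i X_i converge along the m-th selective ultrafilter. The group G
   generated by X and the coordinates of these limits has G^K countably pracompact, the almost
   constant points of \prod_i X_i being the dense set. As an element of G is a finite sum of
   ultrafilters on X, sequences in G have few accumulation points; for D dense in G^L with all its
   infinite subsets accumulating, each coordinate of D involves boundedly many points of X, from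
   finitely many X_i, and finitely many limits. If L is larger than K, then many coordinates of D use
   the same m sets X_i; density then gives points of D having more than m new elements of X in these
   coordinates. So two sequences of distinct new points a_n, b_n, with a_n and b_n in the same X_i,
   would have to converge in G along a common ultrafilter. That forces two limits in X_i to be
   isomorphic ultrafilters, contradicting incomparability. *)
Require Import Defs.
From HB Require Import structures.
From mathcomp Require Import all_boot all_order all_algebra.
From mathcomp Require Import all_classical all_reals all_analysis.
Set Implicit Arguments. Unset Strict Implicit. Unset Printing Implicit Defensive.
Local Open Scope classical_set_scope.
Local Open Scope card_scope.

(** * Cardinal arithmetic *)

Definition embeds (A B : Type) := exists f : A -> B, injective f.

Lemma embeds_trans A B C : embeds A B -> embeds B C -> embeds A C.
Proof. by move=> [f fi] [g gi]; exists (g \o f); exact: inj_comp. Qed.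

Lemma card_le_embeds (A B : Type) : [set: A] #<= [set: B] <-> embeds A B.
Proof.
split.
  move=> /card_leP [f]; exists (fun x => sval (f (SigSub (mem_setT x)))).
  move=> x y /= e; have /inj : f (SigSub (mem_setT x)) = f (SigSub (mem_setT y)).
    exact: val_inj.
  by move=> /(_ (mem_setT _) (mem_setT _)) [].
move=> [f fi].
have [[b]|nB] := pselect (inhabited B).
  pose pB : pointedType := HB.pack_for pointedType B
    (gen_eqMixin B) (gen_choiceMixin B) (isPointed.Build B b).
  by apply/(@pcard_leP _ pB); apply/injfunPex; exists f => // x y _ _ /fi.
suff -> : [set: A] = set0 by exact: card_ge0.
by apply/seteqP; split => // x _; apply: nB; exists; exact: f x.
Qed.

Lemma embeds_seq A B : embeds A B -> embeds (seq A) (seq B).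
Proof. by move=> [f fi]; exists (map f); exact: inj_map. Qed.

Lemma embeds_pair A B C D : embeds A B -> embeds C D -> embeds (A * C) (B * D).
Proof.
move=> [f fi] [g gi]; exists (fun p => (f p.1, g p.2)).
by move=> [a c] [a' c'] [/fi /= -> /gi ->].
Qed.

Lemma embeds_retract A B : embeds A B -> inhabited A ->
  exists (f : A -> B) (g : B -> A), cancel f g.
Proof.
move=> [f fi] [a].
exists f, (fun b => if pselect (exists a, f a = b) is left e then sval (cid e) else a).
move=> x; case: pselect => [e|[]]; last by exists x.
by case: cid => y /= /fi.
Qed.

(** Zorn's lemma on graphs of partial injections: a maximal graph that misses a point on each side
    could be enlarged by the pair of these points. *)
Lemma embeds_total (T U : Type) : embeds T U \/ embeds U T.
Proof.
pose P (R : set (T * U)) := forall p q, R p -> R q -> (p.1 = q.1 <-> p.2 = q.2).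
have [F FP Ftot|R [Rinj Rmax]] := @Zorn_bigcup _ P.
  move=> p q [R FR Rp] [S FS Sq].
  have [RS|SR] := Ftot _ _ FR FS.
    by apply: (FP _ FS) => //; exact: RS.
  by apply: (FP _ FR) => //; exact: SR.
have [[x xR]|nx] := pselect (exists x, forall y, ~ R (x, y)).
  have [[y yR]|ny] := pselect (exists y, forall x, ~ R (x, y)).
    exfalso; apply: (Rmax (R `|` [set (x, y)])).
      split; first by move=> p; left.
      by move/(_ (x, y)) => /= h; apply: (xR y); apply: h; right.
    move=> p q [Rp|->] [Rq|->] //=.
    - exact: Rinj.
    - case: p Rp => p1 p2 Rp /=; split=> e.
        by case: (xR p2); rewrite -e.
      by case: (yR p1); rewrite -e.
    - case: q Rq => p1 p2 Rp /=; split=> e.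
        by case: (xR p2); rewrite e.
      by case: (yR p1); rewrite e.
  right; have /choice[g gP] : forall y, exists x, R (x, y).
    by move=> y; apply: contrapT => h; apply: ny; exists y => x' ?; apply: h; exists x'.
  by exists g => y z e; apply/(Rinj _ _ (gP _) (gP _)).
left; have /choice[g gP] : forall x, exists y, R (x, y).
  by move=> x; apply: contrapT => h; apply: nx; exists x => y' ?; apply: h; exists y'.
by exists g => y z e; apply/(Rinj _ _ (gP _) (gP _)).
Qed.

Lemma sval_inj (T : Type) (P : T -> Prop) : injective (@sval T P).
Proof. by move=> [x Px] [y Py] /= xy; exact: eq_exist. Qed.

Lemma embeds_seq_pair T : embeds (seq (T * T)) (seq T).
Proof.
exists (fun l => flatten [seq [:: p.1; p.2] | p <- l]).
by elim=> [|[a b] l IH] [|[a' b'] l'] //= [-> -> /IH ->].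
Qed.

(** * Finite lists over an infinite set *)

Section SeqInfinite.
Variable K : eqType.

Let lists (A : set K) : set (seq K) := [set l | l <> [::] /\ forall x, x \in l -> A x].

(* [R] is the graph of an injection of the nonempty lists over [A] into [A]; [A] is determined by [R],
   and a maximal such [R] must have [A] equipotent with the whole of [K]. *)
Let good (R : set (seq K * K)) (A : set K) :=
  [/\ forall l k, R (l, k) -> lists A l /\ A k,
      forall l, lists A l -> exists k, R (l, k) &
      forall p q, R p -> R q -> (p.1 = q.1 <-> p.2 = q.2)].

Let good_dom R A : good R A -> A = [set x | exists k, R ([:: x], k)].
Proof.
move=> [RA AR _]; apply/seteqP; split=> x.
  by move=> Ax; apply: AR; split => // y; rewrite inE => /eqP ->.
by move=> [k /RA[[_ +] _]]; apply; rewrite inE.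
Qed.

(** The extension that will contradict maximality: [c] sends the new lists injectively into [B], so
    its graph does not clash with the values of [R], which lie in [A]. *)
Let good_extend R A B (c : seq K -> K) : good R A -> B !=set0 -> A `&` B = set0 ->
  (forall l, lists (A `|` B) l -> ~ lists A l -> B (c l)) ->
  (forall l l', lists (A `|` B) l -> lists (A `|` B) l' -> ~ lists A l -> ~ lists A l' ->
    c l = c l' -> l = l') ->
  exists2 R', R `<` R' & exists A', good R' A'.
Proof.
move=> gR [b Bb] AB0 cB cinj; have [RA AR Rinj] := gR.
have nb : ~ A b by move=> Ab; have : (A `&` B) b by []; rewrite AB0.
pose C := [set p | p.2 = c p.1 /\ lists (A `|` B) p.1 /\ ~ lists A p.1].
exists (R `|` C).
  split; first by move=> p; left.
  have lb : lists (A `|` B) [:: b] /\ ~ lists A [:: b].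
    split; first by split => // x; rewrite inE => /eqP ->; right.
    by move=> [_ /(_ b)]; rewrite inE eqxx => /(_ isT).
  move=> /(_ ([:: b], c [:: b])) h.
  have /RA[] : R ([:: b], c [:: b]) by apply: h; right.
  by move=> /(proj2 lb).
exists (A `|` B); split.
- move=> l k [/RA[[l0 lA] Ak]|[/= -> [lAB nlA]]].
    by split; [split => // x /lA; left|left].
  by split => //; right; apply: cB.
- move=> l lAB; have [/AR[k Rlk]|nl] := pselect (lists A l).
    by exists k; left.
  by exists (c l); right.
have RC p q : R p -> C q -> (p.1 = q.1 <-> p.2 = q.2).
  case: p => l k /RA[/= lA Ak]; case: q => l' k' [/= -> [lAB nlA]].
  split=> [e|e]; first by case: nlA; rewrite -e.
  have : (A `&` B) k by split => //; rewrite e; exact: cB.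
  by rewrite AB0.
move=> p q [Rp|Cp] [Rq|Cq].
- exact: Rinj.
- exact: RC.
- by have := RC _ _ Rq Cp; split=> /esym h; apply/esym; tauto.
- case: p Cp => l k [/= -> [? ?]]; case: q Cq => l' k' [/= -> [? ?]].
  by split=> [->//|]; exact: cinj.
Qed.

(** For a maximal good [R], either the complement of [A] embeds in [A], and then [K] is no larger
    than two copies of [A], or the complement contains a copy of [A] by which [R] could be
    extended. *)
Lemma embeds_seq_infinite : infinite_set [set: K] -> embeds (seq K) K.
Proof.
move=> /infiniteP /card_le_embeds [f fi].
have [F FP Ftot|R [[A gR] Rmax]] := @Zorn_bigcup _ [set R | exists A, good R A].
  exists [set x | exists k, (\bigcup_(X in F) X) ([:: x], k)]; split.
  - move=> l k [R FR Rlk]; have [A gR] := FP _ FR; have [RA AR _] := gR.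
    have [[l0 lA] Ak] := RA _ _ Rlk; have AE := good_dom gR.
    have Asub x : A x -> exists k, (\bigcup_(X in F) X) ([:: x], k).
      by rewrite AE => -[k' ?]; exists k', R.
    by split; [split => // x /lA|]; exact: Asub.
  - move=> l [l0 lA].
    suff [R FR lR] : exists2 R, F R & forall x, x \in l -> exists k, R ([:: x], k).
      have [A gR] := FP _ FR; have AE := good_dom gR; case: gR => _ AR _.
      have [|k Rlk] := AR l; last by exists k, R.
      by split => // x /lR; rewrite AE.
    elim: l l0 lA => // x l IH _ lA.
    have [k [R FR Rx]] : exists k, (\bigcup_(X in F) X) ([:: x], k).
      by apply: lA; rewrite inE eqxx.
    have [->|/eqP l0] := eqVneq l [::].
      by exists R => // y; rewrite inE => /eqP ->; exists k.
    have [|S FS lS] := IH l0; first by move=> y yl; apply: lA; rewrite inE yl orbT.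
    have [RS|SR] := Ftot _ _ FR FS.
      exists S => // y; rewrite inE => /orP[/eqP ->|/lS//].
      by exists k; exact: RS.
    exists R => // y; rewrite inE => /orP[/eqP ->|/lS[k' ?]]; first by exists k.
    by exists k'; exact: SR.
  move=> p q [R FR Rp] [S FS Sq].
  have [RS|SR] := Ftot _ _ FR FS.
    by have [? [_ _ h]] := FP _ FS; apply: h => //; exact: RS.
  by have [? [_ _ h]] := FP _ FR; apply: h => //; exact: SR.
have [RA AR Rinj] := gR.
have noext B c := fun h1 h2 h3 h4 => let: ex_intro2 R' h h' := @good_extend R A B c gR h1 h2 h3 h4 in Rmax R' h h'.
(* If [A] were empty, the copy [range f] of the naturals, with lists coded by [pickle], would give
   an extension. *)
have [a Aa] : A !=set0.
  apply: contrapT => /set0P/negP/negPn/eqP A0.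
  have listsE l : lists (A `|` range f) l -> exists s, l = map f s.
    rewrite A0 set0U => -[_]; elim: l => [|x l IH] h; first by exists [::].
    have [|s ->] := IH; first by move=> y yl; apply: h; rewrite inE yl orbT.
    by have [|n _ <-] := h x; rewrite ?inE ?eqxx//; exists (n :: s).
  apply: (noext (range f) (fun l => f (if pselect (exists s, l = map f s) is left e then pickle (sval (cid e)) else 0))).
  - by exists (f 0); exists 0.
  - by rewrite A0 set0I.
  - by move=> l _ _; eexists.
  move=> l l' /listsE e /listsE e' _ _ /fi.
  case: pselect => // e1; case: pselect => // e2.
  by case: cid => s /= ->; case: cid => s' /= -> /(pcan_inj pickleK) ->.
pose TA := {x | A x}; pose TB := {x | ~ A x}.
(* [R] acts on nonempty lists, so [a] is prepended to let the empty list in. *)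
have /choice[r rP] : forall l : seq TA, exists k : TA, R (sval (exist _ a Aa) :: map sval l, sval k).
  move=> l; have [|k Rk] := AR (a :: map sval l).
    split => // x; rewrite inE => /orP[/eqP ->//|].
    by elim: l => //= -[y Ay] l IH; rewrite inE => /orP[/eqP ->|/IH].
  by have [_ Ak] := RA _ _ Rk; exists (exist _ k Ak).
have ri : injective r.
  move=> l l' e; have /(Rinj _ _ (rP l) (rP l')) [/inj_map] : sval (r l) = sval (r l') by rewrite e.
  by apply; exact: sval_inj.
have tagA : embeds (bool * TA) (TA * TA).
  apply: (@embeds_trans _ (seq TA * TA)).
    exists (fun p : bool * TA => (nseq p.1 p.2, p.2)) => -[[] x] [[] y] /= [//].
    - by move=> ->.
    - by move=> ->.
  by apply: embeds_pair; [exists r|exists id].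
have [seqA] : embeds (seq (bool * TA)) TA.
  by apply: embeds_trans (ex_intro _ r ri); apply: embeds_trans (embeds_seq_pair _); exact: embeds_seq.
move=> seqAi.
have [[g gi]|[g gi]] := embeds_total TA TB; last first.
  apply: (@embeds_trans _ (seq (bool * TA))); last first.
    by exists (fun l => sval (seqA l)) => x y /sval_inj/seqAi.
  apply: embeds_seq.
  exists (fun x => match pselect (A x) with
                   | left h => (true, exist _ x h)
                   | right h => (false, g (exist _ x h)) end).
  move=> x y; case: pselect => h1; case: pselect => h2 //; first by move=> [].
  by move=> [/gi []].
(* [B] is a copy of [A] in its complement. Points of the union are read as tagged points of [A], and
   [g] moves the code of a list of them into [B]. *)
pose B := range (sval \o g).
have eP x : exists p : bool * TA, (A `|` B) x -> if p.1 then x = sval p.2 else x = sval (g p.2).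
  have [[Ax|[y _ <-]]|n] := pselect ((A `|` B) x).
  - by exists (true, exist _ x Ax).
  - by exists (false, y).
  - by exists (true, exist _ a Aa).
have [e eE] := choice eP.
have einj : {in A `|` B &, injective e}.
  by move=> x y /set_mem/eE + /set_mem/eE; case: (e x) => -[] ?; case: (e y) => -[] ? /= + + []; congruence.
exfalso; apply: (noext B (fun l => sval (g (seqA (map e l))))).
- by exists (sval (g (exist _ a Aa))), (exist _ a Aa).
- apply/seteqP; split => // x [Ax [y _ yx]]; move: Ax; rewrite -yx /=; exact: (svalP (g y)).
- by move=> l _ _; eexists.
move=> l l' [_ h] [_ h'] _ _ E.
have {E} /seqAi E : seqA (map e l) = seqA (map e l').
  by apply: gi; exact: sval_inj E.
elim: l l' h h' E => [|x l IH] [|y l'] //= h h' [exy El]; congr cons.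
  by apply: einj => //; apply: mem_set; [apply: h|apply: h']; rewrite inE eqxx.
by apply: IH => // z zl; [apply: h|apply: h']; rewrite inE zl orbT.
Qed.

End SeqInfinite.

Lemma infinite_uniq_seq (L : choiceType) (A : set L) (n : nat) : infinite_set A ->
  exists s : seq L, [/\ uniq s, size s = n & forall x, x \in s -> A x].
Proof.
move=> /(@infinite_set_fset _ _ n) [B BA Bn].
exists (take n (finmap.enum_fset B)); split; first exact: take_uniq (finmap.fset_uniq B).
  by rewrite size_take_min; apply/minn_idPl.
by move=> x /mem_take xB; exact: BA.
Qed.

(** If all fibres were finite, [L] would embed in the product of [seq K] with the naturals, hence in
    [K]. *)
Lemma infinite_fiber (K : eqType) (L : choiceType) (g : L -> seq K) :
  infinite_set [set: K] -> ~ embeds L K -> exists l, infinite_set [set x | g x = l].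
Proof.
move=> Kinf LK; apply: contrapT => nl; apply: LK.
have fin l : finite_set [set x | g x = l].
  by apply: contrapT => h; apply: nl; exists l.
have /choice[h hinj] : forall l, exists h : L -> nat, {in [set x | g x = l] &, injective h}.
  by move=> l; apply/countable_injP/finite_set_countable.
have [k _] := infinite_setN0 Kinf.
have sK := embeds_seq_infinite Kinf.
apply: (embeds_trans _ sK); apply: (@embeds_trans _ (seq K * seq K)); last first.
  apply: (@embeds_trans _ (K * K)); first exact: embeds_pair.
  by exists (fun p => [:: p.1; p.2]) => -[a b] [c d] /= [-> ->].
(* The number of [x] within its fibre is recorded as the length of a constant list. *)
exists (fun x => (g x, nseq (h (g x) x) k)) => x y [e /(congr1 size)].
rewrite !size_nseq => e'; apply: (hinj (g x)); rewrite ?inE//=.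
by rewrite e' e.
Qed.

(* A type of cardinality 2^c: it indexes the ultrafilters, the coordinates of the ambient power and
   the points of each dense set. *)
Notation MM := (set (set nat)).

(** The identity $(2^{\mathfrak c})^{\omega} = 2^{\mathfrak c}$: [c n A] codes a number and a set as
    one set of naturals, and [f] goes to the disjoint union of its values. *)
Lemma embeds_bigfun : embeds (nat -> MM) MM.
Proof.
pose c (n : nat) (A : set nat) : set nat :=
  [set x | x = pickle (0, n) \/ exists2 k, A k & x = pickle (1, k)].
have cinj n A m B : c n A = c m B -> n = m /\ A = B.
  move=> e; split.
    have : c m B (pickle (0, n)) by rewrite -e; left.
    by move=> [/(pcan_inj pickleK)[]//|[k _ /(pcan_inj pickleK)[]]].
  apply/seteqP; split=> k Ak.
    have : c m B (pickle (1, k)) by rewrite -e; right; exists k.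
    by move=> [/(pcan_inj pickleK)[]//|[k' Bk' /(pcan_inj pickleK)[->]]].
  have : c n A (pickle (1, k)) by rewrite e; right; exists k.
  by move=> [/(pcan_inj pickleK)[]//|[k' Bk' /(pcan_inj pickleK)[->]]].
exists (fun f => [set C | exists n A, f n A /\ C = c n A]) => f g e.
apply/funext => n; apply/seteqP; split=> A fA.
  have : [set C | exists n A, g n A /\ C = c n A] (c n A) by rewrite -e; exists n, A.
  by move=> [m [B [gB /cinj[-> ->]]]].
have : [set C | exists n A, f n A /\ C = c n A] (c n A) by rewrite e; exists n, A.
by move=> [m [B [gB /cinj[-> ->]]]].
Qed.

Lemma embeds_big_seqfun A : embeds A MM -> embeds (nat -> A) MM.
Proof.
move=> [f fi]; apply: embeds_trans embeds_bigfun.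
by exists (fun u n => f (u n)) => u v e; apply/funext => n; apply: fi; exact: (congr1 (@^~ n) e).
Qed.

Lemma embeds_big_pair A B : embeds A MM -> embeds B MM -> embeds (A * B) MM.
Proof.
move=> [f fi] [g gi]; apply: embeds_trans embeds_bigfun.
exists (fun p n => if n is 0 then f p.1 else g p.2) => -[a b] [a' b'] e.
by move: (congr1 (@^~ 0) e) (congr1 (@^~ 1) e) => /= /fi -> /gi ->.
Qed.

Lemma embeds_big_bool : embeds bool MM.
Proof.
exists (fun b => if b then setT else set0) => -[] [] //= /seteqP[] h h' //.
  by case: (h set0 I).
by case: (h' set0 I).
Qed.

Lemma embeds_big_option A : embeds A MM -> embeds (option A) MM.
Proof.
move=> AM; have [i ii] := embeds_big_pair embeds_big_bool AM.
have [[a]|nA] := pselect (inhabited A).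
  apply: (@embeds_trans _ (bool * A)); last by exists i.
  by exists (fun o => if o is Some x then (true, x) else (false, a)) => -[x|] [y|] //= [->].
by exists (fun=> setT) => -[x|] [y|] // _; exfalso; apply: nA.
Qed.

Lemma embeds_big_seq A : embeds A MM -> embeds (seq A) MM.
Proof.
move=> /embeds_big_option/embeds_big_seqfun; apply: embeds_trans.
exists (fun l n => nth None (map some l) n).
elim=> [|x l IH] [|y l'] //= e; do ?by have := congr1 (@^~ 0) e.
have [->] := congr1 (@^~ 0) e; congr cons; apply: IH.
by apply/funext => n; exact: (congr1 (@^~ n.+1) e).
Qed.

(** Cantor's diagonal argument: [D] collects the singletons [[set n]] missing from every [r] whose
    image has number [n]. Whether [D] contains the singleton of its own number is contradictory. *)
Lemma big_uncountable (i : MM -> MM) (Q : set MM) : injective i -> countable Q ->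
  exists r, ~ Q (i r).
Proof.
move=> ii /countable_injP[f fi]; apply: contrapT => h.
have Qi r : Q (i r) by apply: contrapT => ?; apply: h; exists r.
pose D : MM := [set A | exists n, A = [set n] /\ forall r, f (i r) = n -> ~ r [set n]].
have [DD|nDD] := pselect (D [set f (i D)]).
  by case: (DD) => n [/seteqP[/(_ _ erefl)/= <- _] /(_ D erefl)].
apply: (nDD); exists (f (i D)); split => // r e.
by rewrite (ii _ _ (fi _ _ (mem_set (Qi r)) (mem_set (Qi D)) e)).
Qed.

(** * Subspaces of powers of the two-point space *)

Lemma ptws_cvg (U : Type) (V : topologicalType) (F : set_system (U -> V))
    (f : {ptws U -> V}) : Filter F ->
  (forall t, (fun g => g t) @ F --> f t) -> F --> f.
Proof.
move=> FF h; apply/cvg_sup => i B; rewrite nbhsE => -[W0 [[C Cop <-] Cf] WB].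
by apply: (filterS WB); apply: (h i); exact: open_nbhs_nbhs.
Qed.

Lemma ptws_eval_continuous (U : eqType) (V : topologicalType) (t : U) :
  continuous (fun f : {ptws U -> V} => f t).
Proof. exact: (@proj_continuous U (fun=> V) t). Qed.

Section Cube.
Variables (T : eqType) (A : set {ptws T -> bool}).

(** A list [l] of pairs (factor, coordinate) stands for a basic neighbourhood of [d] in the power of
    [A]. *)
Definition agree (L : Type) (d d' : L -> A) (l : seq (L * T)) :=
  all (fun p => val (d' p.1) p.2 == val (d p.1) p.2) l.

Lemma agree_cat L (d d' : L -> A) l1 l2 :
  agree d d' (l1 ++ l2) = agree d d' l1 && agree d d' l2.
Proof. exact: all_cat. Qed.

Let agree_filter (L : Type) (d : L -> A) : set_system (L -> A) :=
  [set W | exists l, forall d', agree d d' l -> W d'].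

Let agree_filterP L (d : L -> A) : Filter (agree_filter d).
Proof.
split; first by exists [::].
  move=> P Q [l1 h1] [l2 h2]; exists (l1 ++ l2) => d'.
  by rewrite agree_cat => /andP[/h1 ? /h2 ?].
by move=> P Q PQ [l h]; exists l => d' /h /PQ.
Qed.

Lemma cube_coord_continuous (a : T) : continuous (fun g : A => val g a : bool).
Proof.
move=> g; apply: (@continuous_comp _ _ _ (fun g : A => set_val g : {ptws T -> bool}) (fun f => f a)).
  exact: (@initial_continuous A {ptws T -> bool} set_val).
exact: ptws_eval_continuous.
Qed.

Lemma cube_coord_nbhs (g : A) (a : T) : nbhs g [set x : A | val x a = val g a].
Proof.
by apply: (@cube_coord_continuous a g [set val g a]); exact/principal_filterP.
Qed.

Lemma cube_cvg (F : set_system A) (g : A) : Filter F ->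
  (forall a, F [set g' | val g' a = val g a]) -> F --> g.
Proof.
move=> FF h B; rewrite nbhsE => -[W0 [[C Cop <-] Cg] WB].
apply: (filterS WB).
have cv : (set_val @ F) --> (set_val g : {ptws T -> bool}).
  apply: ptws_cvg => a D /nbhs_singleton Da.
  have := h a; apply: (@filterS _ F) => g' /= e.
  by move: Da; rewrite set_valE /= e.
by apply: cv; exact: open_nbhs_nbhs.
Qed.

Lemma power_cvg (L : Type) (F : set_system (L -> A)) (d : {ptws L -> A}) :
  Filter F -> (forall i a, F [set d' | val (d' i) a = val (d i) a]) -> F --> d.
Proof. by move=> FF h; apply: ptws_cvg => i; apply: cube_cvg => a; exact: h. Qed.

Lemma power_nbhs_agree (L : Type) (d : {ptws L -> A}) (W : set {ptws L -> A}) :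
  nbhs d W -> exists l, forall d', agree d d' l -> W d'.
Proof.
suff : agree_filter d --> d by apply.
apply: (power_cvg (agree_filterP d)) => i a; exists [:: (i, a)] => d'.
by rewrite /agree /= andbT => /eqP.
Qed.

Lemma agree_nbhs (L : eqType) (d : {ptws L -> A}) l : nbhs d [set d' | agree d d' l].
Proof.
elim: l => [|[i a] l IH]; first by apply: filterS (@filterT _ (nbhs d) _).
have h : nbhs d [set d' : {ptws L -> A} | val (d' i) a = val (d i) a].
  have c := @continuous_comp _ _ _ (fun f : {ptws L -> A} => f i) (fun g : A => val g a : bool) d
    (@ptws_eval_continuous L _ i d) (@cube_coord_continuous a (d i)).
  by apply: (c [set val (d i) a]); exact/principal_filterP.
by apply: filterS2 h IH => d' /= e h; rewrite /agree /= e eqxx.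
Qed.

Lemma dense_agreeP (L : eqType) (D : set {ptws L -> A}) :
  dense D <-> forall (d : L -> A) l, exists2 d', D d' & agree d d' l.
Proof.
split=> [Dd d l|h O [d Od] Oop].
  have := @agree_nbhs L d l; rewrite nbhsE => -[W0 [Oop Od] Oagr].
  by have [|d' [/Oagr ? ?]] := Dd W0 _ Oop; [exists d|exists d'].
have [|l hl] := @power_nbhs_agree L d O; first exact: open_nbhs_nbhs.
by have [d' Dd' /hl Od'] := h d l; exists d'.
Qed.

(** Each of the finitely many terms before [n0] that differ from [p] is excluded by one coordinate;
    the neighbourhood shrunk by these coordinates still contains a term other than [p]. *)
Lemma limit_point_seq (L : eqType) (f : nat -> {ptws L -> A}) p :
  injective f -> limit_point (range f) p ->
  forall l n0, exists2 n, n0 <= n & agree p (f n) l.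
Proof.
move=> fi fp l n0.
suff [l' hl'] : exists l', forall n, n < n0 -> f n <> p -> ~~ agree p (f n) l'.
  have [q [/eqP np [n _ fn]]] := fp _ (agree_nbhs p (l ++ l')); subst q.
  rewrite /= agree_cat => /andP[agl agl'].
  by exists n => //; rewrite leqNgt; apply/negP => /hl' /(_ np) /negP.
elim: n0 => [|n0 [l' hl']]; first by exists [::].
have [e|ne] := pselect (f n0 = p).
  by exists l' => n; rewrite ltnS leq_eqVlt => /orP[/eqP -> //|/hl'].
have [i [a ia]] : exists i a, val (f n0 i) a <> val (p i) a.
  apply: contrapT => h; apply: ne; apply/funext => i; apply/val_inj/funext => a.
  by apply: contrapT => ?; apply: h; exists i, a.
exists ((i, a) :: l') => n; rewrite ltnS leq_eqVlt => /orP[/eqP -> _|nn0 np].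
  by rewrite /agree /= negb_and; apply/orP; left; exact/eqP.
by have := hl' n nn0 np; rewrite /agree /= negb_and orbC => ->.
Qed.

Lemma cube_hausdorff : hausdorff_space A.
Proof.
move=> g h gh; apply/val_inj/funext => a; apply: contrapT => ne.
by have [x [/= e1 e2]] := gh _ _ (cube_coord_nbhs g a) (cube_coord_nbhs h a); case: ne; exact: etrans (esym e1) e2.
Qed.

Hypothesis A0 : A (fun=> false).
Hypothesis AD : forall f g, A f -> A g -> A (fun a => f a (+) g a).

Definition cube0 : A := SigSub (mem_set A0).
Definition cube_add (g h : A) : A :=
  SigSub (mem_set (AD (set_mem (valP g)) (set_mem (valP h)))).

Lemma cube_topological_group : topological_group cube_add id cube0.
Proof.
split.
- by move=> x y z; apply/val_inj/funext => a; exact: addbA.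
- by move=> x; apply/val_inj/funext => a; exact: addFb.
- by move=> x; apply/val_inj/funext => a; exact: addbb.
- move=> [x y]; apply: cube_cvg => a; rewrite /=.
  exists ([set x' : A | val x' a = val x a], [set y' : A | val y' a = val y a]); first by split; exact: cube_coord_nbhs.
  by move=> [x' y'] [/= ex ey]; rewrite ex ey.
- by move=> x; exact: cvg_id.
Qed.

End Cube.

(** * Ultrafilters and parities *)

Definition ultra (T : Type) (u : set (set T)) : Prop :=
  [/\ u setT, ~ u set0, (forall A B, u A -> A `<=` B -> u B),
      (forall A B, u A -> u B -> u (A `&` B)) & forall A, u A \/ u (~` A)].

Definition free_ultra (T : Type) (u : set (set T)) := forall x, ~ u [set x].

Definition principal (T : Type) (x : T) : set (set T) := [set B | B x].

Section Ultra.
Variable T : Type.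
Implicit Types (u v z : set (set T)) (A B : set T) (x : T).

Lemma ultraC u A : ultra u -> u (~` A) <-> ~ u A.
Proof.
move=> [uT u0 uS uI uC]; split=> [uA' uA|]; last by case: (uC A).
by apply: u0; rewrite -(setICr A); exact: uI.
Qed.

Lemma ultraS u A B : ultra u -> u A -> A `<=` B -> u B.
Proof. by move=> [_ _ uS _ _]; exact: uS. Qed.

Lemma ultraI u A B : ultra u -> u A -> u B -> u (A `&` B).
Proof. by move=> [_ _ _ uI _]; exact: uI. Qed.

Lemma ultraU u A B : ultra u -> u (A `|` B) -> u A \/ u B.
Proof.
move=> uu uAB; apply: contrapT => /not_orP[/(ultraC A uu) h /(ultraC B uu) h'].
have := ultraI uu h h'; rewrite -setCU => /(ultraC _ uu); exact.
Qed.

Lemma ultra_disjoint u A B : ultra u -> u A -> u B -> exists x, A x /\ B x.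
Proof.
move=> uu uA uB; apply: contrapT => h; have [_ u0 _ _ _] := uu.
apply: u0; have : u (A `&` B) by exact: ultraI.
by move/(ultraS uu); apply=> x [Ax Bx]; apply: h; exists x.
Qed.

Lemma ultra_le_eq u v : ultra u -> ultra v -> u `<=` v -> u = v.
Proof.
move=> uu vu uv; apply/seteqP; split=> // A vA; apply: contrapT => /(ultraC A uu)/uv.
by move/(ultraC A vu).
Qed.

Lemma ultra_principal x : ultra (principal x).
Proof. by split => // [A B Ax AB|A]; [exact: AB|exact: EM]. Qed.

Lemma ultra_set1 u x : ultra u -> u [set x] -> u = principal x.
Proof.
move=> uu ux; apply/esym/ultra_le_eq => //; first exact: ultra_principal.
by move=> A Ax; apply: (ultraS uu ux) => y ->.
Qed.

Lemma ultra_cases z : ultra z -> free_ultra z \/ exists x, z = principal x.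
Proof.
move=> zu; have [[x zx]|n] := pselect (exists x, z [set x]).
  by right; exists x; exact: ultra_set1.
by left=> x zx; apply: n; exists x.
Qed.

Lemma principal_inj : injective (@principal T).
Proof.
by move=> x y e; have : principal y [set x] by rewrite -e.
Qed.

Lemma ultra_image (S : Type) (u : set (set S)) (f : S -> T) :
  ultra u -> ultra [set B | u (f @^-1` B)].
Proof.
move=> [uT u0 uS uI uC]; split => //.
- by move=> A B uA AB; apply: (uS _ _ uA) => x; exact: AB.
- by move=> A B uA uB; exact: uI.
- by move=> A; exact: uC.
Qed.

Lemma ultra_preimage (S : Type) u (f : S -> T) : ultra u -> injective f ->
  u (range f) -> ultra [set N | u (f @` N)].
Proof.
move=> uu fi ur; have [_ u0 uS uI uC] := uu; split => //=.
- by rewrite image_set0.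
- by move=> A B uA AB; apply: (uS _ _ uA); exact: image_subset.
- move=> A B uA uB; apply: (uS _ _ (uI _ _ uA uB)) => x [[a Aa <-] [b Bb /fi ba]].
  by exists a => //; split=> //; rewrite -ba.
- move=> A; have : u (f @` A `|` f @` (~` A)) by rewrite -image_setU setUv.
  exact: ultraU.
Qed.

Lemma ultra_separate (l1 l2 : seq (set (set T))) :
  (forall u, u \in l1 -> ultra u) -> (forall v, v \in l2 -> ultra v) ->
  (forall u v, u \in l1 -> v \in l2 -> u <> v) ->
  exists B, (forall u, u \in l1 -> u B) /\ (forall v, v \in l2 -> ~ v B).
Proof.
elim: l1 => [|u l1 IH] U1 U2 ne.
  by exists set0; split=> // v /U2[].
have uu : ultra u by apply: U1; rewrite inE eqxx.
have [| //| |B [B1 B2]] := IH.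
- by move=> w wl; apply: U1; rewrite inE wl orbT.
- by move=> w v wl vl; apply: ne => //; rewrite inE wl orbT.
have [C [uC C2]] : exists C, u C /\ forall v, v \in l2 -> ~ v C.
  have {ne} : forall v, v \in l2 -> u <> v by move=> v; apply: ne; rewrite inE eqxx.
  elim: l2 U2 {B2 IH} => [|v l2 IH] U2 ne; first by exists setT; split => //; case: uu.
  have vu : ultra v by apply: U2; rewrite inE eqxx.
  have [||C [uC C2]] := IH.
  - by move=> w wl; apply: U2; rewrite inE wl orbT.
  - by move=> w wl; apply: ne; rewrite inE wl orbT.
  have [D uD vD] : exists2 D, u D & ~ v D.
    apply: contrapT => h; apply: (ne v); first by rewrite inE eqxx.
    by apply: ultra_le_eq => // A uA; apply: contrapT => ?; apply: h; exists A.
  exists (C `&` D); split; first exact: ultraI.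
  move=> w; rewrite inE => /orP[/eqP ->|wl].
    by move=> /(ultraS vu) h; apply/vD/h => x [].
  have wu : ultra w by apply: U2; rewrite inE wl orbT.
  by move=> /(ultraS wu) h; apply/(C2 w wl)/h => x [].
exists (B `|` C); split=> w.
  rewrite inE => /orP[/eqP ->|wl]; first by apply: (ultraS uu uC) => x; right.
  have wu : ultra w by apply: U1; rewrite inE wl orbT.
  by apply: (ultraS wu (B1 w wl)) => x; left.
by move=> wl /(ultraU (U2 w wl))[/(B2 w wl)|/(C2 w wl)].
Qed.

(** An ultrafilter contains at most one of several pairwise disjoint sets, so the pigeonhole
    principle leaves one set over. *)
Lemma ultra_avoid_disjoint (l : seq (set (set T))) (E : nat -> set T) (J : seq nat) :
  (forall u, u \in l -> ultra u) ->
  (forall i j, i \in J -> j \in J -> i <> j -> E i `&` E j = set0) ->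
  uniq J -> size l < size J -> exists2 j, j \in J & forall u, u \in l -> ~ u (E j).
Proof.
elim: l J => [|u l IH] J U dis uJ lJ.
  by case: J lJ {uJ dis} => // j J _; exists j => //; rewrite inE eqxx.
have uu : ultra u by apply: U; rewrite inE eqxx.
have Ul v : v \in l -> ultra v by move=> vl; apply: U; rewrite inE vl orbT.
have [[i iJ uEi]|n] := pselect (exists2 i, i \in J & u (E i)); last first.
  have [|j jJ jl] := IH J Ul dis uJ; first exact: ltnW.
  exists j => // v; rewrite inE => /orP[/eqP -> uEj|/jl//].
  by apply: n; exists j.
have [|||j] := IH (rem i J) Ul.
- by move=> a b /mem_rem aJ /mem_rem bJ; exact: dis.
- exact: rem_uniq.
- by rewrite size_rem //; move: lJ => /=; case: (size J).
rewrite mem_rem_uniq // inE => /andP[/eqP ji jJ] jl; exists j => // v.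
rewrite inE => /orP[/eqP ->|/jl//] uEj.
have [x [Eix Ejx]] := ultra_disjoint uu uEi uEj.
have : (E j `&` E i) x by [].
by rewrite dis.
Qed.

End Ultra.

Lemma free_avoid_seq (T : eqType) (u : set (set T)) (l : seq T) :
  ultra u -> free_ultra u -> ~ u [set` l].
Proof.
move=> uu fu; elim: l => [|x l IH].
  by rewrite set_nil; case: uu.
have -> : [set` x :: l] = [set x] `|` [set` l].
  apply/seteqP; split=> y /=; rewrite inE.
    by move=> /orP[/eqP|]; [left|right].
  by move=> [->|->]; rewrite ?eqxx ?orbT.
by move=> /(ultraU uu)[/fu|].
Qed.

Lemma injective_avoid_seq (T : eqType) (v : nat -> T) (l : seq T) : injective v ->
  exists n0, forall n, n0 <= n -> v n \notin l.
Proof.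
move=> vi; elim: l => [|x l [n0 h]]; first by exists 0.
have [[m vm]|n] := pselect (exists m, v m = x).
  exists (maxn n0 m.+1) => n; rewrite geq_max => /andP[/h vl mn].
  rewrite inE negb_or vl andbT -vm; apply/eqP => /vi e.
  by rewrite e ltnn in mn.
exists n0 => m /h vl; rewrite inE negb_or vl andbT; apply/eqP => e.
by apply: n; exists m.
Qed.

Lemma injective_of_lt (T : Type) (f : nat -> T) :
  (forall m n, m < n -> f m <> f n) -> injective f.
Proof.
by move=> h m n e; case: (ltngtP m n) => // /h; [move/(_ e)|move/(_ (esym e))].
Qed.

(** Otherwise each [v] fails at some list, and all of them would fail at the concatenation of these
    finitely many lists. *)
Lemma exists_forall_swap (I T : eqType) (l : seq I) (R : I -> seq T -> Prop) :
  (forall v (P P' : seq T), {subset P' <= P} -> R v P -> R v P') ->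
  (forall P, exists2 v, v \in l & R v P) -> exists2 v, v \in l & forall P, R v P.
Proof.
move=> mono h; apply: contrapT => n.
have /choice[P PP] : forall v, exists P, v \in l -> ~ R v P.
  move=> v; have [vl|] := pselect (v \in l); last by exists [::].
  apply: contrapT => h'; apply: n; exists v => // P; apply: contrapT => nR.
  by apply: h'; exists P.
have [v vl] := h (flatten (map P l)).
move/mono => /(_ (P v)) h'; apply: (PP v vl); apply: h' => x xP.
by apply/flattenP; exists (P v) => //; exact: map_f.
Qed.

Lemma not_uniq_map (I T : eqType) (g : I -> T) (s : seq I) : uniq s -> ~~ uniq (map g s) ->
  exists x y, [/\ x \in s, y \in s, x <> y & g x = g y].
Proof.
move=> us /negP n; apply: contrapT => h; apply: n; rewrite map_inj_in_uniq // => x y xs ys e.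
by apply: contrapT => ne; apply: h; exists x, y.
Qed.

(** Recursive choice in which a new term may depend on the list of all earlier ones. *)
Lemma seq_choice (E : eqType) (R : seq E -> E -> Prop) :
  (forall l, exists e, R l e) -> exists f : nat -> E, forall n, R (mkseq f n) (f n).
Proof.
move=> /choice[g gP].
pose h := fix h n := if n is m.+1 then rcons (h m) (g (h m)) else [::].
exists (g \o h) => n; suff -> : mkseq (g \o h) n = h n by exact: gP.
by elim: n => // n IH; rewrite mkseqS IH.
Qed.

Lemma mem_mkseq_lt (E : eqType) (f : nat -> E) n k : k < n -> f k \in mkseq f n.
Proof. by move=> kn; apply/mapP; exists k; rewrite ?mem_iota. Qed.

(** * Parities of finite sums of ultrafilters *)

Section Parity.
Variable T : eqType.
Implicit Types (s t : seq (set (set T))) (A B : set T) (z : set (set T)).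

(** The sum modulo 2 of the ultrafilters in [s], seen as 0/1-valued functions of sets, evaluated at
    [B]. *)
Definition par s B := \big[addb/false]_(z <- s) `[< z B >].

Lemma par_cat s t B : par (s ++ t) B = par s B (+) par t B.
Proof. by rewrite /par big_cat. Qed.

Lemma eq_par s A B : (forall z, z \in s -> z A <-> z B) -> par s A = par s B.
Proof.
move=> h; apply: eq_big_seq => z zs; have zAB := h z zs.
by apply/asboolP/asboolP => /zAB.
Qed.

Lemma par_eq0 s B : (forall z, z \in s -> ~ z B) -> par s B = false.
Proof.
by move=> h; apply: big1_seq => z /= /h zB; apply/asboolP.
Qed.

Lemma par_setU s A B : (forall z, z \in s -> ultra z) -> A `&` B = set0 ->
  par s (A `|` B) = par s A (+) par s B.
Proof.
move=> su AB0; rewrite /par -big_split; apply: eq_big_seq => z zs /=; have zu := su z zs.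
have [zA|nzA] := asboolP (z A); have [zB|nzB] := asboolP (z B); apply/asboolP => /=.
- by have [x ABx] := ultra_disjoint zu zA zB; have : (A `&` B) x by []; rewrite AB0.
- by apply: (ultraS zu zA) => x; left.
- by apply: (ultraS zu zB) => x; right.
- by move/(ultraU zu) => [].
Qed.

Lemma par_uniq s : exists t, [/\ uniq t, {subset t <= s} & par t = par s].
Proof.
elim: s => [|z s [t [tu ts pt]]]; first by exists [::].
have [zt|zt] := boolP (z \in t).
  exists (rem z t); split; first exact: rem_uniq.
    by move=> x /mem_rem /ts xs; rewrite inE xs orbT.
  apply/funext => B; rewrite /par big_cons -/(par s B) -pt.
  by rewrite [par t B](perm_big _ (perm_to_rem zt)) big_cons /= addKb.
exists (z :: t); split; first by rewrite /= zt.
  by move=> x; rewrite !inE => /orP[->//|/ts ->]; rewrite orbT.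
by apply/funext => B; rewrite /par !big_cons -/(par s B) -/(par t B) pt.
Qed.

Lemma par1 s z B : uniq s -> z \in s -> z B ->
  (forall z', z' \in s -> z' <> z -> ~ z' B) -> par s B.
Proof.
move=> su zs zB h; rewrite /par (perm_big _ (perm_to_rem zs)) big_cons.
rewrite (asboolT zB) -/(par (rem z s) B) par_eq0// => z'.
by rewrite mem_rem_uniq // inE => /andP[/eqP ne /h]; apply.
Qed.

Let principal_pt z := if pselect (exists x : T, z = principal x) is left e
  then Some (sval (cid e)) else None.

Definition pts s : seq T := pmap principal_pt s.

Let principal_ptP z x : principal_pt z = Some x <-> z = principal x.
Proof.
rewrite /principal_pt; split.
  by case: pselect => // e [<-]; case: cid.
move=> ->; case: pselect => [e|[]]; last by exists x.
congr Some; apply/esym/principal_inj; exact: (svalP (cid e)).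
Qed.

Lemma mem_pts s x : (x \in pts s) = (principal x \in s).
Proof.
rewrite mem_pmap; apply/mapP/idP => [[z zs /esym/principal_ptP <-]//|xs].
by exists (principal x) => //; apply/esym/principal_ptP.
Qed.

Lemma pts_uniq s : uniq s -> uniq (pts s).
Proof.
elim: s => //= z s IH /andP[zs /IH us]; rewrite /pts /=.
case e : (principal_pt z) => [x|] //=; rewrite us andbT.
by rewrite -/(pts s) mem_pts -((principal_ptP z x).1 e).
Qed.

Lemma par_pts s B : (forall z, z \in s -> ultra z) ->
  par s B = (\big[addb/false]_(x <- pts s) `[< B x >]) (+)
            \big[addb/false]_(z <- s | `[< free_ultra z >]) `[< z B >].
Proof.
rewrite /par; elim: s => [|z s IH] su; first by rewrite !big_nil.
have zu : ultra z by apply: su; rewrite inE eqxx.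
rewrite !big_cons IH; last by move=> w ws; apply: su; rewrite inE ws orbT.
rewrite /pts /=; case e : (principal_pt z) => [x|] /=.
  have zx := (principal_ptP z x).1 e.
  have nf : ~ free_ultra z by rewrite zx => /(_ x); apply.
  by rewrite big_cons (asboolF nf) zx addbA.
have fz : free_ultra z by move=> x /(ultra_set1 zu)/principal_ptP; rewrite e.
by rewrite (asboolT fz) addbCA.
Qed.

(* The choices "E n is part of B" are made one after the other, each fixing
   the parity of [s n] on B once and for all. *)
Lemma triangular_parity (s : nat -> seq (set (set T))) (t : seq (set (set T)))
    (E : nat -> set T) :
  (forall n z, z \in s n -> ultra z) -> (forall z, z \in t -> ultra z) ->
  (forall m n, m <> n -> E m `&` E n = set0) ->
  (forall n z, z \in s n -> ~ z (\bigcup_(m in [set m | n < m]) E m)) ->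
  (forall n, par (s n) (E n)) ->
  (forall z, z \in t -> ~ z (\bigcup_n E n)) ->
  exists B, (forall n, par (s n) B) /\ par t B = false.
Proof.
move=> su tu dis later diag tE.
(* [E m] is added exactly when [s m] is even on the part chosen so far. By [diag] this makes it odd,
   and by [later] no later choice changes it. *)
pose P := fix P n := if n is m.+1 then
  (if par (s m) (P m) then P m else P m `|` E m) else set0.
have PE n : P n `<=` \bigcup_(m in [set m | m < n]) E m.
  elim: n => // n IH x /=.
  have IH' : P n x -> (\bigcup_(m in [set m | m < n.+1]) E m) x.
    by move=> /IH[m /= mn Emx]; exists m => //=; exact: ltnW.
  case: ifP => _ // [//|Enx]; by exists n => /=.
have PI n : P n `&` E n = set0.
  apply/seteqP; split=> // x [/PE[m /= mn Emx] Enx].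
  have /dis/seteqP[+ _] : m <> n by move=> e; rewrite e ltnn in mn.
  by apply; split; [exact: Emx|].
have Pmono n k : P n `<=` P (n + k).
  elim: k => [|k IH]; first by rewrite addn0.
  by rewrite addnS => x /IH /= h; case: ifP => _ //; left.
have Plater n : \bigcup_k P k `<=` P n.+1 `|` \bigcup_(m in [set m | n < m]) E m.
  move=> x [k _]; elim: k => // k IH.
  rewrite [P k.+1]/=; case: ifP => pk; first exact: IH.
  move=> [/IH//|Ekx]; have [kn|nk] := leqP k n; last by right; exists k.
  left; rewrite -(subnKC kn); have -> : (k + (n - k)).+1 = k.+1 + (n - k) by [].
  by apply: Pmono; rewrite /= pk; right.
exists (\bigcup_k P k); split=> [n|].
  have -> : par (s n) (\bigcup_k P k) = par (s n) (P n.+1).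
    apply: eq_par => z zs; split=> zP; last first.
      by apply: (ultraS (su _ _ zs) zP) => x ?; exists n.+1.
    have := ultraS (su _ _ zs) zP (@Plater n).
    by move/(ultraU (su _ _ zs)) => [//|/(later _ _ zs)].
  rewrite /=; case: ifP => [//|pn].
  by rewrite par_setU ?pn ?diag //; exact: su.
apply: par_eq0 => z zt zP; apply: (tE z zt); apply: (ultraS (tu z zt) zP).
by move=> x [k _ /PE[m _ Emx]]; exists m.
Qed.

(** * Selective ultrafilters and their separation by disjoint sets *)

Definition selective_ultra z := forall g : T -> nat,
  (exists c, z [set x | g x = c]) \/
  (exists2 B, z B & forall x y, B x -> B y -> g x = g y -> x = y).

(** Selective ultrafilters are P-points. Let [g x] be the first [n] such that [x] is outside [C n].
    It cannot be constant on a member of [z], and on a set where it is injective only finitely many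
    points lie outside [C n], since [g] is at most [n] there. *)
Lemma pseudo_intersection z (C : nat -> set T) : ultra z -> selective_ultra z ->
  (forall n, z (C n)) -> exists2 B, z B & forall n, finite_set (B `\` C n).
Proof.
move=> zu zs zC.
have [zI|/(ultraC _ zu) zI] := pselect (z (\bigcap_n C n)).
  exists (\bigcap_n C n) => // n; have -> : \bigcap_n C n `\` C n = set0.
    by apply/seteqP; split=> // x [/(_ n I)].
  exact: finite_set0.
have /choice[g gP] : forall x, exists n, (exists m, ~ C m x) ->
    ~ C n x /\ forall m, ~ C m x -> n <= m.
  move=> x; have [[m Cm]|n] := pselect (exists m, ~ C m x); last by exists 0 => /n.
  have ex : exists m, `[< ~ C m x >] by exists m; exact/asboolP.
  by case: (ex_minnP ex) => n /asboolP nC min; exists n => _; split=> // k /asboolP/min.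
have gex x : (~` \bigcap_n C n) x -> exists m, ~ C m x.
  by move=> h; apply: contrapT => h'; apply: h => m _; apply: contrapT => ?; apply: h'; exists m.
have [[c zc]|[B zB Binj]] := zs g.
  have [x [[/= gx nx] Ccx]] := ultra_disjoint zu (ultraI zu zc zI) (zC c).
  by have [] := gP x (gex x nx); rewrite gx.
exists (B `&` ~` \bigcap_n C n); first exact: ultraI.
move=> n; set F := _ `\` _.
have gF : {in F &, injective g}.
  by move=> x y /set_mem[[Bx _] _] /set_mem[[By _] _]; exact: Binj.
rewrite -(eq_finite_set (inj_card_eq gF)); apply: (@sub_finite_set _ _ `I_n.+1).
  by move=> _ [x [[_ /gex/gP[_ min]] nC] <-]; rewrite /= ltnS; exact: min.
exact: finite_II.
Qed.

(** By the P-point property [z] has a member [B z] that is, up to a finite set, contained in sets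
    excluding each other element of [W]. So no other element contains [B z], and it remains to
    subtract the finitely many earlier sets in an enumeration of [W]. *)
Lemma selective_discrete (W : set (set (set T))) : countable W ->
  (forall z, W z -> [/\ ultra z, free_ultra z & selective_ultra z]) ->
  exists A : set (set T) -> set T, (forall z, W z -> z (A z)) /\
    forall z w, W z -> W w -> z <> w -> A z `&` A w = set0.
Proof.
move=> /countable_injP[idx idx_inj] Wus.
have idxI z w : W z -> W w -> idx z = idx w -> z = w.
  by move=> Wz Ww; apply: idx_inj; exact: mem_set.
have Wu z : W z -> ultra z by move=> /Wus[].
have /choice[B BP] : forall z, exists B, W z -> z B /\ forall w, W w -> w <> z -> ~ w B.
  move=> z; have [Wz|] := pselect (W z); last by exists set0.
  have [zu zf zs] := Wus z Wz.
  have /choice[C CP] : forall n, exists C, z C /\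
      forall w, W w -> idx w = n -> w <> z -> ~ w C.
    move=> n; have [[w [Ww wn wz]]|h] := pselect (exists w, [/\ W w, idx w = n & w <> z]).
      have [C wC zC] : exists2 C, w C & ~ z C.
        apply: contrapT => h; apply: wz; apply: ultra_le_eq => //; first exact: Wu.
        by move=> C wC; apply: contrapT => zC; apply: h; exists C.
      exists (~` C); split; first exact/ultraC.
      by move=> v Wv vn _ /(ultraC _ (Wu v Wv)); rewrite (idxI v w) // vn.
    by exists setT; split; [case: zu|move=> w Ww wn wz; case: h; exists w].
  have [B zB Bfin] := pseudo_intersection zu zs (fun n => proj1 (CP n)).
  exists B => _; split=> // w Ww wz wB; have [wu wf _] := Wus w Ww.
  have : w ((B `\` C (idx w)) `|` C (idx w)).
    by apply: (ultraS wu wB) => x Bx; have [?|?] := pselect (C (idx w) x); [right|left].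
  move/(ultraU wu) => [|wC]; last exact: (proj2 (CP (idx w)) w Ww erefl wz).
  by have /finite_seqP[l ->] := Bfin (idx w); exact: free_avoid_seq.
pose V k := [set x | exists w, [/\ W w, idx w < k & B w x]].
have zV z k : W z -> k <= idx z -> ~ z (V k).
  move=> Wz; have zu := Wu z Wz; elim: k => [_|k IH kz].
    have -> : V 0 = set0 by apply/seteqP; split=> // x [w []].
    by case: zu.
  have [[w [Ww wk]]|h] := pselect (exists w, W w /\ idx w = k).
    have Vk : V k.+1 `<=` V k `|` B w.
      move=> x [v [Wv]]; rewrite ltnS leq_eqVlt => /orP[/eqP vk Bvx|vk Bvx].
        by right; rewrite (idxI w v) // wk vk.
      by left; exists v.
    move=> /(ultraS zu)/(_ Vk)/(ultraU zu)[|zBw]; first by apply: IH; exact: ltnW.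
    by apply: (proj2 (BP w Ww) z Wz) => // e; rewrite e wk ltnn in kz.
  have Vk : V k.+1 `<=` V k.
    move=> x [v [Wv]]; rewrite ltnS leq_eqVlt => /orP[/eqP vk|vk Bvx].
      by case: h; exists v.
    by exists v.
  by move=> /(ultraS zu)/(_ Vk); apply: IH; exact: ltnW.
exists (fun z => B z `&` ~` V (idx z)); split=> [z Wz|z w Wz Ww zw].
  have zu := Wu z Wz; apply: ultraI => //; first by case: (BP z Wz).
  by apply/ultraC => //; exact: zV.
wlog : z w Wz Ww zw / idx z < idx w => [hwlog|lt].
  case: (ltngtP (idx z) (idx w)) => [|lt|/(idxI _ _ Wz Ww)//]; first exact: hwlog.
  by rewrite setIC; apply: hwlog => // e; exact: zw.
by apply/seteqP; split=> // x [[Bz _] [_]]; apply; exists z.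
Qed.

End Parity.

(** * The group *)

Fixpoint lookup (A : eqType) (B : Type) (d : B) (l : seq (A * B)) (a : A) : B :=
  if l is p :: l' then if p.1 == a then p.2 else lookup d l' a else d.

Lemma lookup_map (A : eqType) (B : Type) (d : B) (f : A -> B) l a : a \in l ->
  lookup d [seq (x, f x) | x <- l] a = f a.
Proof.
elim: l => //= x l IH; rewrite inE eq_sym.
by case: eqVneq => [-> //|_ /= /IH].
Qed.

Lemma lookup_notin (A : eqType) (B : Type) (d : B) (l : seq (A * B)) a :
  a \notin map fst l -> lookup d l a = d.
Proof.
elim: l => //= x l IH; rewrite inE negb_or eq_sym => /andP[/negbTE -> /IH].
exact.
Qed.

(** [phi a] is the set of points whose [a]-th coordinate is 1. The set [B] encodes a 0/1 assignment
    on the countable set [C]. *)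
Definition countably_free (K M : Type) (phi : M -> set (K * M)) :=
  forall (C B : set (K * M)) (Q : set M), countable C -> countable Q ->
    exists2 a, ~ Q a & forall x, C x -> (phi a x <-> B x).

(** Density, in the power indexed by [M], of each set of points [(i, m)] with [i] fixed. *)
Definition finitely_generic (K : Type) (M : eqType) (phi : M -> set (K * M)) :=
  forall i (l : seq M) (v : M -> bool),
    exists m, forall a, a \in l -> `[< phi a (i, m) >] = v a.

Lemma generic_sets (K : choiceType) : embeds K MM ->
  exists phi : MM -> set (K * MM), countably_free phi /\ finitely_generic phi.
Proof.
move=> KM.
have idM : embeds MM MM by exists id.
have [i [s si]] : exists (i : seq (MM * bool) -> MM) s, cancel i s.
  apply: embeds_retract; last exact: (inhabits [::]).
  by apply: embeds_big_seq; apply: embeds_big_pair => //; exact: embeds_big_bool.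
have [j [c cj]] : exists (j : (nat -> option (K * MM)) * MM -> MM) c, cancel j c.
  apply: embeds_retract; last exact: (inhabits ((fun=> None), set0)).
  apply: embeds_big_pair => //; apply: embeds_big_seqfun.
  by apply: embeds_big_option; exact: embeds_big_pair.
(* [a] codes a countable set of points, the second component of [c a] being a dummy that repeats each
   code uncountably often; [m] codes a finite partial function [s m], which has precedence at [(i, m)]. *)
pose phi (a : MM) : set (K * MM) := [set x |
  lookup `[< exists n, (c a).1 n = Some x >] (s x.2) a].
exists phi; split.
  move=> C B Q Cc Qc.
  have /countable_injP[h hi] := Cc.
  have /choice[e eP] : forall n, exists o : option (K * MM),
      forall x, o = Some x <-> [/\ C x, B x & h x = n].
    move=> n; have [[x [Cx Bx hx]]|nx] := pselect (exists x, [/\ C x, B x & h x = n]).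
      exists (Some x) => y; split=> [[<-]//|[Cy _ hy]]; congr Some.
      by apply: hi; rewrite ?inE // hx hy.
    by exists None => y; split=> // ?; case: nx; exists y.
  (* The finite functions of the points of [C] prescribe only countably many coordinates. Outside
     them the code in [a] decides. *)
  pose Q' := Q `|` \bigcup_(x in C) [set a | a \in map fst (s x.2)].
  have Qc' : countable Q'.
    rewrite /Q' -bigcup2E; apply: bigcup_countable => // -[|[|n]] _ //=.
      apply: bigcup_countable => // x _; apply: finite_set_countable; exact: finite_seq.
  have [|r nQ] := @big_uncountable (fun r => j (e, r)) Q' _ Qc'.
    by move=> r r' /(can_inj cj)[].
  exists (j (e, r)) => [Qj|x Cx]; first by apply: nQ; left.
  rewrite /phi /= lookup_notin; last first.
    by apply/negP => jx; apply: nQ; right; exists x.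
  rewrite cj /=; split=> [/asboolP[n /eP[]]//|Bx].
  by apply/asboolP; exists (h x); apply/eP.
move=> k l v; exists (i [seq (x, v x) | x <- l]) => a al.
by rewrite /phi /= si lookup_map // asboolb.
Qed.

(** If the range of [f] is finite, some fibre is in [p]; otherwise the fibres, numbered by the
    naturals, form a partition to which selectivity applies. *)
Lemma selective_fun (p : set (set nat)) (T : Type) (f : nat -> T) : selective p ->
  (exists c, p [set n | f n = c]) \/
  (exists2 B, p B & forall x y, B x -> B y -> f x = f y -> x = y).
Proof.
move=> [pu _ psel].
have Rc : countable (range f) by apply: card_le_trans (card_image_le _ _) _; exact: card_lexx.
have [/(@finite_seqP {classic T})[l fl]|Rinf] := pselect (finite_set (range f)).
  left; have : p (f @^-1` [set` l]).
    by have [pT _ _ _ _] := pu; rewrite -fl (_ : f @^-1` _ = setT) //; apply/seteqP; split=> // x _; exists x.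
  elim: l {fl} => [|c l IH].
    by rewrite set_nil preimage_set0; case: pu.
  have -> : f @^-1` [set` c :: l] = f @^-1` [set c] `|` f @^-1` [set` l].
    apply/seteqP; split=> x /=; rewrite inE.
      by move=> /orP[/eqP|]; [left|right].
    by move=> [->|->]; rewrite ?eqxx ?orbT.
  by move=> /(ultraU pu)[pc|//]; exists c.
pose T' : pointedType := HB.pack_for pointedType T
    (gen_eqMixin T) (gen_choiceMixin T) (isPointed.Build T (f 0)).
have /(@card_set_bijP nat T')[b [bR bi bs]] : [set: nat] #= range f.
  by rewrite card_eq_sym; exact: eq_card_nat.
have [|[n pn]|[B [pB Bn]]] := psel (fun n => f @^-1` [set b n]).
- split.
  + by move=> n; have [x _ xn] := bR n I; exists x.
  + move=> m n mn; apply/seteqP; split=> // x [/= -> /bi]; rewrite !inE.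
    by move=> /(_ I I).
  + by move=> x; have [n _ bn] := bs (f x) (ex_intro2 _ _ x I erefl); exists n; exact/esym.
- by left; exists (b n).
right; exists B => // x y Bx By fxy.
have [n _ bn] := bs (f x) (ex_intro2 _ _ x I erefl).
have [w [_ wu]] := Bn n.
by rewrite -(wu x) ?(wu y) //=; split=> //; rewrite -?fxy.
Qed.

(** * The group of words in points and limit ultrafilters *)

Section Words.
Variable K : choiceType.
Local Notation X := (K * MM)%type.
Variables (phi : MM -> set X) (U : MM -> set (set nat)) (F : MM -> nat -> K -> MM).
Hypothesis phi_free : countably_free phi.
Hypothesis phi_generic : finitely_generic phi.
Hypothesis U_selective : forall e, selective (U e).
Hypothesis U_incomparable : forall e e', e <> e' -> RK_incomparable (U e) (U e').
Hypothesis F_onto : forall l : nat -> seq X,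
  exists e, forall n i, F e n i = lookup set0 (l n) i.

(* The i-th coordinate of the limit along [U e] of the e-th sequence. *)
Definition lim_ultra e i : set (set X) := [set B | U e [set n | B (i, F e n i)]].

Definition gens : set (set (set X)) :=
  [set z | (exists x, z = principal x) \/ exists e i, z = lim_ultra e i].

(* An ultrafilter [z] on [X] stands for the point [a |-> z (phi a)] of the power. *)
Definition words : set {ptws MM -> bool} :=
  [set g | exists2 s, forall z, z \in s -> gens z & g = fun a => par s (phi a)].

Lemma U_ultra e : ultra (U e).
Proof. by case: (U_selective e). Qed.

Lemma U_free e : free_ultra (U e).
Proof.
case: (U_selective e) => uu ff _ n un; have [A [uA nA]] := ff n.
by have [x [/= -> ]] := ultra_disjoint uu un uA.
Qed.

Lemma lim_ultra_ultra e i : ultra (lim_ultra e i).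
Proof. exact: (ultra_image (fun n => (i, F e n i)) (U_ultra e)). Qed.

Lemma gens_ultra z : gens z -> ultra z.
Proof. by move=> [[x ->]|[e [i ->]]]; [exact: ultra_principal|exact: lim_ultra_ultra]. Qed.

Lemma gens_free z : gens z -> free_ultra z -> exists e i, z = lim_ultra e i.
Proof. by move=> [[x ->] /(_ x)|//]; case. Qed.

Lemma lim_ultra_fst e i : lim_ultra e i [set x | x.1 = i].
Proof.
rewrite /lim_ultra /=; have [uT _ _ _ _] := U_ultra e.
by rewrite (_ : [set n | _] = setT) //; apply/seteqP; split.
Qed.

Lemma lim_ultra_selective e i : selective_ultra (lim_ultra e i).
Proof.
move=> g; have [[c Uc]|[B UB Binj]] := selective_fun (fun n => g (i, F e n i)) (U_selective e).
  by left; exists c.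
right; exists ((fun n => (i, F e n i)) @` B).
  by apply: (ultraS (U_ultra e) UB) => n Bn; exists n.
by move=> _ _ [n Bn <-] [m Bm <-] /(Binj _ _ Bn Bm) ->.
Qed.

Lemma gens_countable z : gens z -> exists2 C, countable C & z C.
Proof.
move=> [[x ->]|[e [i ->]]]; first by exists [set x] => //; exact: countable1.
exists (range (fun n => (i, F e n i))).
  by apply: card_le_trans (card_image_le _ _) _; exact: card_lexx.
rewrite /lim_ultra /=; have [uT _ _ _ _] := U_ultra e.
by rewrite (_ : [set n | _] = setT) //; apply/seteqP; split=> // n _; exists n.
Qed.

(** Every generator contains a countable set, so the parities of the [s n] are decided on countably
    many points, where some [phi a] agrees with [B]. Arbitrary sets can thus be used as
    coordinates. *)
Lemma par_free (s : nat -> seq (set (set X))) (B : set X) (Q : set MM) :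
  (forall n z, z \in s n -> gens z) -> countable Q ->
  exists2 a, ~ Q a & forall n, par (s n) (phi a) = par (s n) B.
Proof.
move=> sg Qc.
have /choice[c cP] : forall z, exists C, countable C /\ (gens z -> z C).
  move=> z; have [/gens_countable[C Cc zC]|nz] := pselect (gens z); first by exists C.
  by exists set0; split=> //; exact: countable0.
have Wc : countable (\bigcup_n \bigcup_(z in [set z | z \in s n]) c z).
  apply: bigcup_countable => // n _; apply: bigcup_countable.
    by apply: finite_set_countable; exact: finite_seq.
  by move=> z _; case: (cP z).
have [a nQ aB] := phi_free B Wc Qc; exists a => // n.
apply: eq_par => z zs; have zg := sg n z zs; have zu := gens_ultra zg.
have zc := (proj2 (cP z)) zg.
split=> zP; apply: (ultraS zu (ultraI zu zc zP)) => x [cx Px].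
  by apply/aB => //; exists n => //; exists z.
by apply/aB => //; exists n => //; exists z.
Qed.

Lemma words0 : words (fun=> false).
Proof. by exists [::] => //; apply/funext => a; rewrite /par big_nil. Qed.

Lemma wordsD f g : words f -> words g -> words (fun a => f a (+) g a).
Proof.
move=> [s sg ->] [t tg ->]; exists (s ++ t); last by apply/funext => a; rewrite par_cat.
by move=> z; rewrite mem_cat => /orP[/sg|/tg].
Qed.

Lemma supp_subproof (g : words) : exists s, [/\ uniq s, forall z, z \in s -> gens z &
  forall a, val g a = par s (phi a)].
Proof.
have [s sg gE] := set_mem (valP g); have [t [tu ts pt]] := par_uniq s.
by exists t; split => // [z /ts /sg //|a]; rewrite pt gE.
Qed.

(** A chosen representation of [g] as a sum of distinct generators. *)
Definition supp (g : words) := sval (cid (supp_subproof g)).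

Lemma supp_uniq g : uniq (supp g).
Proof. by rewrite /supp; case: cid => s /= []. Qed.

Lemma supp_gens g z : z \in supp g -> gens z.
Proof. by rewrite /supp; case: cid => s /= [] _ + _; apply. Qed.

Lemma supp_ultra g z : z \in supp g -> ultra z.
Proof. by move/supp_gens/gens_ultra. Qed.

Lemma suppE g a : val g a = par (supp g) (phi a).
Proof. by rewrite /supp; case: cid => s /= [] _ _; apply. Qed.

Lemma word_subproof z : gens z -> words (fun a => `[< z (phi a) >]).
Proof.
move=> zg; exists [:: z]; first by move=> w; rewrite inE => /eqP ->.
by apply/funext => a; rewrite /par big_seq1.
Qed.

Definition word z (zg : gens z) : words := SigSub (mem_set (word_subproof zg)).

Lemma gens_principal x : gens (principal x).
Proof. by left; exists x. Qed.

Lemma gens_lim e i : gens (lim_ultra e i).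
Proof. by right; exists e, i. Qed.

(** The dense set consists of the almost constant points, with [(i, set0)] in all but finitely many
    factors; genericity makes it dense. A sequence of such points is the [e]-th one for some [e] and
    converges along [U e]. *)
Lemma words_power_countably_pracompact : countably_pracompact {ptws K -> words}.
Proof.
pose d l : {ptws K -> words} := fun i => word (gens_principal (i, lookup set0 l i)).
exists (range d); split.
  apply/dense_agreeP => t l.
  have /choice[m mP] : forall i, exists m, forall a, a \in map snd l ->
      `[< phi a (i, m) >] = val (t i) a by move=> i; exact: phi_generic.
  exists (d [seq (i, m i) | i <- map fst l]) => //.
  apply/allP => -[i a] il /=.
  rewrite /d /= lookup_map; last by apply/mapP; exists (i, a).
  by apply/eqP/mP; apply/mapP; exists (i, a).
move=> A Ad /infiniteP/card_leP[f'].
pose f n : {ptws K -> words} := sval (f' (SigSub (mem_setT n))).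
have fA n : A (f n) by exact: set_mem (valP (f' (SigSub (mem_setT n)))).
have fi : injective f.
  move=> n m /val_inj /('inj_f') h.
  by have := h (mem_setT _) (mem_setT _) => -[].
have /choice[l lP] : forall n, exists l, d l = f n.
  by move=> n; have [l _ <-] := Ad _ (fA n); exists l.
have [e eP] := F_onto l.
pose p : {ptws K -> words} := fun i => word (gens_lim e i).
exists p => W /power_nbhs_agree[ls hls].
have agU : U e [set n | agree p (f n) ls].
  have [uT _ _ _ _] := U_ultra e.
  elim: ls {hls} => [|[i a] ls IH].
    by rewrite (_ : [set n | _] = setT) //; apply/seteqP; split.
  have Ui : U e [set n | val (f n i) a = val (p i) a].
    rewrite /p /= /lim_ultra /=.
    have fE n : val (f n i) a = `[< phi a (i, F e n i) >] by rewrite -lP /= eP.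
    have [h|h] := pselect (U e [set n | phi a (i, F e n i)]).
      by apply: (ultraS (U_ultra e) h) => n /= pn; rewrite fE !asboolT.
    rewrite (asboolF h); have {h} h := (ultraC _ (U_ultra e)).2 h.
    by apply: (ultraS (U_ultra e) h) => n /= pn; rewrite fE asboolF.
  apply: (ultraS (U_ultra e) (ultraI (U_ultra e) Ui IH)) => n [/= h1 h2].
  by rewrite /agree /= h1 eqxx.
(* The limit [p] may itself be a term, but only once; as [U e] is free, another term lies in the
   neighbourhood. *)
have [n [agn np]] : exists n, agree p (f n) ls /\ f n <> p.
  apply: contrapT => h; have [n [agn _]] := ultra_disjoint (U_ultra e) agU agU.
  have fn : f n = p by apply: contrapT => ?; apply: h; exists n.
  apply: (@U_free e n); apply: (ultraS (U_ultra e) agU) => m /= agm.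
  by apply: fi; rewrite fn; apply: contrapT => ?; apply: h; exists m.
by exists (f n); split; [exact/eqP|exact: fA|exact: hls].
Qed.

(* An ultrafilter that is the image of both [u] and [v] would make [U e] and [U e'] isomorphic. *)
Lemma lim_ultra_pullback_neq u v (x y : nat -> X) : gens u -> free_ultra u -> gens v -> free_ultra v ->
  injective x -> injective y -> (forall k n, x k <> y n) -> (forall n, (x n).1 = (y n).1) ->
  u (range x) -> v (range y) ->
  [set N | u (x @` N)] <> [set N | v (y @` N)].
Proof.
move=> /gens_free h /h[e [i ->]] /gens_free h' /[dup] vfree /h'[e' [i' vE]] {h h' u} xi yi xy xy1 ux vy uv.
have uvN N : lim_ultra e i (x @` N) -> v (y @` N).
  by move=> h; have : [set N | lim_ultra e i (x @` N)] N by []; rewrite uv.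
have uu := lim_ultra_ultra e i; have vu : ultra v by rewrite vE; exact: lim_ultra_ultra.
have ii' : i = i'.
  have /uvN vN : lim_ultra e i (x @` [set n | (x n).1 = i]).
    apply: (ultraS uu (ultraI uu ux (lim_ultra_fst e i))) => w [[n _ <-] /= xn].
    by exists n.
  have vi : v [set w | w.1 = i'] by rewrite vE; exact: lim_ultra_fst.
  have [w [[n /= <- <-] /= <-]] := ultra_disjoint vu vN vi.
  exact: xy1.
(* If [e = e'], then [u] and [v] coincide, but they contain the disjoint ranges of [x] and [y]. *)
subst i'; have [ee|ee] := pselect (e = e').
  have [w [[k _ <-] [n _ /esym/xy//]]] : exists w, range x w /\ range y w.
  by apply: (ultra_disjoint uu) => //; rewrite ee -vE.
have [_ nle] := U_incomparable ee; apply: nle.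
have [[c Uc]|[B UB Binj]] := selective_fun (fun n => F e' n i) (U_selective e').
  exfalso; apply: (vfree (i, c)); rewrite vE /lim_ultra /=.
  by apply: (ultraS (U_ultra e') Uc) => n /= ->.
(* Indices of the two sequences are matched through [x k] and [y k]: [n] determines [k] because [x]
   is injective, and [k] determines [n'] because [F e' n' i] is injective in [n'] on [B]. The
   resulting [g] carries [U e] to [U e']. *)
pose R n k n' := [/\ x k = (i, F e n i), B n' & y k = (i, F e' n' i)].
have /choice[g gP] : forall n, exists n', (exists k m, R n k m) -> exists k, R n k n'.
  move=> n; have [[k [m h]]|h] := pselect (exists k m, R n k m).
    by exists m => _; exists k.
  by exists 0.
exists g; apply: ultra_le_eq; [exact: U_ultra|exact/ultra_image/U_ultra|].
move=> A UA /=.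
pose N := [set k | exists n', [/\ A n', B n' & y k = (i, F e' n' i)]].
have vN : v (y @` N).
  rewrite vE in vy *.
  apply: (ultraS (U_ultra e') (ultraI (U_ultra e') (ultraI (U_ultra e') UA UB) vy)).
  by move=> n' [[An' Bn'] [k _ yk]]; exists k => //; exists n'.
have uN : lim_ultra e i (x @` N).
  by have : [set N | v (y @` N)] N by []; rewrite -uv.
apply: (ultraS (U_ultra e) uN) => n [k [n' [An' Bn' yk]] xk].
have [|k' [xk' Bg ykg]] := gP n; first by exists k, n'.
have kk' : k' = k by apply: xi; rewrite xk xk'.
suff gn : g n = n' by rewrite /preimage /= gn.
by apply: Binj => //; move: ykg; rewrite kk' yk => -[].
Qed.

(** * Dense sets whose infinite subsets accumulate *)

Section Accumulation.
Variables (k0 : K) (L : choiceType) (D : set {ptws L -> words}).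
Hypothesis D_dense : forall (d : L -> words) l, exists2 d', D d' & agree d d' l.
Hypothesis D_acc : forall f : nat -> {ptws L -> words}, injective f -> (forall n, D (f n)) ->
  exists p : {ptws L -> words}, forall l n0, exists2 n, n0 <= n & agree p (f n) l.

Local Notation sup d xi := (supp ((d : {ptws L -> words}) xi)).

(** By [par_free] the parities on [B] and [B'] of the countably many words involved are values at
    coordinates, so accumulation at [p] controls them. *)
Lemma cluster_par (f : nat -> {ptws L -> words}) : injective f -> (forall n, D (f n)) ->
  exists p : {ptws L -> words}, forall xi eta B B' n0, exists2 n, n0 <= n &
    par (sup (f n) xi) B = par (sup p xi) B /\
    par (sup (f n) eta) B' = par (sup p eta) B'.
Proof.
move=> fi fD; have [p pP] := D_acc fi fD; exists p => xi eta B B' n0.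
have hs B1 th : exists a, forall n, par (if n is m.+1 then sup (f m) th else sup p th) (phi a) =
    par (if n is m.+1 then sup (f m) th else sup p th) B1.
  have [|a _ aP] := @par_free (fun n => if n is m.+1 then sup (f m) th else sup p th) B1 set0 _ (countable0 _).
    by move=> [|n] z /supp_gens.
  by exists a.
have [a aP] := hs B xi; have [b bP] := hs B' eta.
have [n nn0] := pP [:: (xi, a); (eta, b)] n0.
rewrite /agree /= andbT !suppE => /andP[/eqP ea /eqP eb].
exists n => //; split.
  by rewrite -(aP 0) -(aP n.+1).
by rewrite -(bP 0) -(bP n.+1).
Qed.

(** With [t] the support of an accumulation point, some set would be odd for all terms from [n0] on
    and even for the accumulation point. The list [t] is arbitrary because that point is not known
    beforehand. *)
Lemma no_triangular xi (f : nat -> {ptws L -> words}) : injective f -> (forall n, D (f n)) ->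
  ~ forall t : seq (set (set X)), (forall z, z \in t -> gens z) -> exists n0 (E : nat -> set X),
    [/\ forall m n, m <> n -> E m `&` E n = set0,
      forall n z, z \in sup (f (n0 + n)) xi -> ~ z (\bigcup_(m in [set m | n < m]) E m),
      forall n, par (sup (f (n0 + n)) xi) (E n) &
      forall z, z \in t -> ~ z (\bigcup_n E n)].
Proof.
move=> fi fD h; have [p pP] := cluster_par fi fD.
have [|n0 [E [dis later diag tE]]] := h (sup p xi); first by move=> z /supp_gens.
have [||B [B1 B2]] := @triangular_parity _ (fun n => sup (f (n0 + n)) xi) (sup p xi) E _ _ dis later diag tE.
- by move=> n z /supp_ultra.
- by move=> z /supp_ultra.
have [n nn0 [e _]] := pP xi xi B B n0.
by have := B1 (n - n0); rewrite subnKC // e B2.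
Qed.

(* Selective ultrafilters are P-points, so infinitely many of them can be separated by disjoint sets. *)
Lemma free_bounded xi : exists T : seq (set (set X)), (forall z, z \in T -> gens z /\ free_ultra z) /\
  forall d, D d -> forall z, z \in sup d xi -> free_ultra z -> z \in T.
Proof.
suff [T TP] : exists T : seq (set (set X)), forall d, D d -> forall z, z \in sup d xi -> free_ultra z -> z \in T.
  exists [seq z <- T | `[< gens z /\ free_ultra z >]]; split.
    by move=> z; rewrite mem_filter => /andP[/asboolP].
  move=> d Dd z zs zf; rewrite mem_filter (TP d) // andbT; apply/asboolP.
  by split=> //; exact: supp_gens zs.
apply: contrapT => nT.
have [|f fP] := @seq_choice {ptws L -> words} (fun l d => D d /\ exists z,
    [/\ z \in sup d xi, free_ultra z & forall d', d' \in l -> z \notin sup d' xi]).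
  move=> l; apply: contrapT => h; apply: nT.
  exists (flatten [seq sup d xi | d <- l]) => d Dd z zs zf; apply: contrapT => zl.
  apply: h; exists d; split=> //; exists z; split=> // d' d'l; apply/negP => zd'.
  by apply: zl; apply/flattenP; exists (sup d' xi) => //; apply/mapP; exists d'.
have fD n := proj1 (fP n); have /choice[y yP] := fun n => proj2 (fP n).
have ys n : y n \in sup (f n) xi by case: (yP n).
have yf n : free_ultra (y n) by case: (yP n).
have yl m n : m < n -> y n \notin sup (f m) xi.
  by move=> mn; case: (yP n) => _ _; apply; exact: mem_mkseq_lt.
have yi : injective y by apply: injective_of_lt => m n /yl + e; rewrite -e ys.
apply: (@no_triangular xi f) => //.
  by apply: injective_of_lt => m n /yl + e; rewrite e ys.
move=> t tg; have [n0 n0P] := injective_avoid_seq t yi.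
pose W := [set z | free_ultra z /\ (z \in t \/ exists n, z \in sup (f n) xi)].
have Wg z : W z -> gens z by move=> [_ [/tg//|[n /supp_gens]]].
have Wc : countable W.
  apply: (@sub_countable _ _ _ ([set` t] `|` \bigcup_n [set` sup (f n) xi])).
    by apply: subset_card_le => z [_ [zt|[n zn]]]; [left|right; exists n].
  rewrite -bigcup2E; apply: bigcup_countable => // -[|[|n]] _ //=.
    by apply: finite_set_countable; exact: finite_seq.
  by apply: bigcup_countable => // n _; apply: finite_set_countable; exact: finite_seq.
have [|A [WA Adis]] := selective_discrete Wc.
  move=> z Wz; have zg := Wg z Wz; split; [exact: gens_ultra|by case: Wz|].
  by have [e [i ->]] := gens_free zg (proj1 Wz); exact: lim_ultra_selective.
have Wy n : W (y n) by split=> //; right; exists n.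
(* Removing these points keeps the principal ultrafilters of [t] and of earlier terms away from
   [E n]. The range includes [k = n], so that the parity of the term on [E n] comes from
   [y (n0 + n)] alone. *)
pose P n := pts t ++ flatten [seq pts (sup (f (n0 + k)) xi) | k <- iota 0 n.+1].
pose E n := A (y (n0 + n)) `\` [set` P n].
exists n0, E.
have EA z n : W z -> z <> y (n0 + n) -> forall x, A z x -> ~ E n x.
  move=> Wz zy x Azx [Ayx _].
  by have : (A z `&` A (y (n0 + n))) x by []; rewrite Adis.
have EP m n x : principal x \in sup (f (n0 + n)) xi -> n <= m -> ~ E m x.
  move=> xs nm [_]; apply => /=; rewrite mem_cat; apply/orP; right; apply/flattenP.
  exists (pts (sup (f (n0 + n)) xi)); last by rewrite mem_pts.
  by apply/mapP; exists n => //; rewrite mem_iota.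
split.
- move=> m n mn; apply/seteqP; split=> // x [[Ax _]]; apply: EA Ax => //.
  by move=> /yi/addnI.
- move=> n z zs zU; have zu := supp_ultra zs; case: (ultra_cases zu) => [zf|[x zx]].
    have Wz : W z by split=> //; right; exists (n0 + n).
    have [x [Ax [m /= nm Em]]] := ultra_disjoint zu (WA z Wz) zU.
    apply: (EA z m Wz _ x Ax Em) => zy.
    by have := yl (n0 + n) (n0 + m); rewrite -zy zs ltn_add2l => /(_ nm).
  subst z; case: zU => m /= nm; exact: EP zs (ltnW nm).
- move=> n; apply: (@par1 _ _ (y (n0 + n))).
  + exact: supp_uniq.
  + exact: ys.
  + have yu : ultra (y (n0 + n)) by exact: supp_ultra (ys _).
    apply: ultraI => //; first exact: WA.
    by apply/ultraC => //; exact: free_avoid_seq.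
  move=> z zs zy zE; have zu := supp_ultra zs; case: (ultra_cases zu) => [zf|[x zx]].
    have Wz : W z by split=> //; right; exists (n0 + n).
    have [x [Ax Ex]] := ultra_disjoint zu (WA z Wz) zE.
    exact: (EA z n Wz zy x Ax Ex).
  by subst z; exact: EP zs (leqnn n) zE.
- move=> z zt zU; have zu := gens_ultra (tg z zt); case: (ultra_cases zu) => [zf|[x zx]].
    have Wz : W z by split=> //; left.
    have [x [Ax [m _ Em]]] := ultra_disjoint zu (WA z Wz) zU.
    apply: (EA z m Wz _ x Ax Em) => zy.
    by have := n0P (n0 + m) (leq_addr _ _); rewrite -zy zt.
  by subst z; case: zU => m _ [_]; apply; rewrite /= mem_cat mem_pts zt.
Qed.

(** The triangular situation with singletons of new points as [E n]: the free ultrafilters in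
    question belong to [t ++ T] and do not contain the set of all these points. *)
Lemma no_point_sequence xi (T : seq (set (set X))) (f : nat -> {ptws L -> words}) :
  (forall d, D d -> forall z, z \in sup d xi -> free_ultra z -> z \in T) ->
  injective f -> (forall n, D (f n)) ->
  ~ forall t : seq (set (set X)), (forall z, z \in t -> gens z) -> exists n0 (x : nat -> X),
    [/\ forall n, n0 <= n -> x n \in pts (sup (f n) xi),
      forall m n, n0 <= m -> m < n -> x n \notin pts (sup (f m) xi) &
      forall u, u \in t ++ T -> free_ultra u -> ~ u (x @` [set n | n0 <= n])].
Proof.
move=> TP fi fD h; apply: (@no_triangular xi f) => // t tg.
have [n0 [x [xs xl xT]]] := h t tg.
have xi' : injective (fun n => x (n0 + n)).
  apply: injective_of_lt => m n mn e.
  have := xl (n0 + m) (n0 + n) (leq_addr _ _); rewrite ltn_add2l => /(_ mn).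
  by rewrite -e xs // leq_addr.
(* From [n1] on the points no longer occur in [t]. *)
have [n1 n1P] := injective_avoid_seq (pts t) xi'.
exists (n0 + n1), (fun n => [set x (n0 + n1 + n)]); split.
- move=> m n mn; apply/seteqP; split=> // w [/= ->]; rewrite -!addnA => /xi'.
  by move=> /addnI.
- move=> n z zs zU; have zu := supp_ultra zs; case: (ultra_cases zu) => [zf|[w zw]].
    apply: (xT z) => //; first by rewrite mem_cat (TP (f (n0 + n1 + n))) ?orbT.
    apply: (ultraS zu zU) => w [m _ /= ->]; exists (n0 + n1 + m) => //=.
    by rewrite -addnA leq_addr.
  subst z; case: zU => m /= nm ew; have := xl (n0 + n1 + n) (n0 + n1 + m).
  by rewrite -ew mem_pts zs -addnA leq_addr addnA ltn_add2l => /(_ isT nm).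
- move=> n; apply: (@par1 _ _ (principal (x (n0 + n1 + n)))) => //.
  + exact: supp_uniq.
  + by rewrite -mem_pts xs // -addnA leq_addr.
  by move=> z zs zx /(ultra_set1 (supp_ultra zs)).
- move=> z zt zU; have zu := gens_ultra (tg z zt); case: (ultra_cases zu) => [zf|[w zw]].
    apply: (xT z) => //; first by rewrite mem_cat zt.
    apply: (ultraS zu zU) => w [m _ /= ->]; exists (n0 + n1 + m) => //=.
    by rewrite -addnA leq_addr.
  subst z; case: zU => m _ /= ew.
  by have := n1P (n1 + m) (leq_addr _ _); rewrite addnA -ew mem_pts zt.
Qed.

(* With more than [size (t ++ T)] new points at each step, one of as many disjoint selections of them
   belongs to no member of [t ++ T]. *)
Lemma pts_bounded xi : exists k, forall d, D d -> size (pts (sup d xi)) <= k.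
Proof.
apply: contrapT => nk.
have big k : exists2 d, D d & k < size (pts (sup d xi)).
  apply: contrapT => h; apply: nk; exists k => d Dd; rewrite leqNgt; apply/negP => kd.
  by apply: h; exists d.
have [d0 _] := big 0; case: (pts (sup d0 xi)) => [//|x0 _ _].
pose seen (l : seq {ptws L -> words}) := flatten [seq pts (sup d xi) | d <- l].
pose new l (d : {ptws L -> words}) := [seq x <- pts (sup d xi) | x \notin seen l].
have [|f fP] := @seq_choice {ptws L -> words} (fun l d => D d /\ size l < size (new l d)).
  move=> l; have [d Dd dl] := big (size (seen l) + size l); exists d; split=> //.
  rewrite -(ltn_add2l (size (seen l))); apply: (leq_trans dl).
  rewrite -(count_predC [in seen l]) size_filter leq_add2r -size_filter.
  apply: uniq_leq_size; first by rewrite filter_uniq // pts_uniq // supp_uniq.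
  by move=> x; rewrite mem_filter => /andP[].
have fD n := proj1 (fP n).
(* For [j <= n] this is a genuine new point, since the [n]-th term has more than [n] of them. *)
pose x j n := nth x0 (new (mkseq f n) (f n)) j.
have xnew j n : j <= n -> x j n \in new (mkseq f n) (f n).
  by move=> jn; apply: mem_nth; apply: leq_ltn_trans jn _; have [_] := fP n; rewrite size_mkseq.
have xs j n : j <= n -> x j n \in pts (sup (f n) xi).
  by move=> /xnew; rewrite mem_filter => /andP[].
have xl j m n : j <= n -> m < n -> x j n \notin pts (sup (f m) xi).
  move=> /xnew; rewrite mem_filter => /andP[+ _] mn; apply: contra => xm.
  apply/flattenP; exists (pts (sup (f m) xi)) => //; apply/mapP; exists (f m) => //.
  exact: mem_mkseq_lt.
have [T [Tg TP]] := free_bounded xi.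
apply: (@no_point_sequence xi T f) => //.
  by apply: injective_of_lt => m n mn e; have := xl 0 m n (leq0n _) mn; rewrite e xs.
move=> t tg; pose q := size (t ++ T).
have uu u : u \in t ++ T -> ultra u.
  by rewrite mem_cat => /orP[/tg/gens_ultra|/Tg[/gens_ultra]].
(* There are [q.+1] disjoint selections for [q] ultrafilters; starting at [q] makes all of them
   defined. *)
have [|||j] := @ultra_avoid_disjoint _ (t ++ T) (fun j => x j @` [set n | q <= n]) (iota 0 q.+1) uu.
- move=> i j; rewrite !mem_iota !add0n !ltnS => iq jq ij; apply/seteqP; split=> // w [].
  move=> [n /= qn <-] [m /= qm]; have [lt|lt|e] := ltngtP m n.
  + by move=> e; have := xl i m n (leq_trans iq qn) lt; rewrite -e xs // (leq_trans jq).
  + by move=> e; have := xl j n m (leq_trans jq qm) lt; rewrite e xs // (leq_trans iq).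
  + subst m; move/eqP; rewrite nth_uniq; first by move=> /eqP/esym/ij.
    * by apply: leq_ltn_trans (leq_trans jq qn) _; have [_] := fP n; rewrite size_mkseq.
    * by apply: leq_ltn_trans (leq_trans iq qn) _; have [_] := fP n; rewrite size_mkseq.
    * by rewrite filter_uniq // pts_uniq // supp_uniq.
- exact: iota_uniq.
- by rewrite size_iota.
rewrite mem_iota add0n ltnS => jq jP.
exists q, (x j); split.
- by move=> n qn; apply: xs; exact: leq_trans qn.
- by move=> m n qm mn; apply: xl => //; apply: leq_trans (ltnW mn); exact: leq_trans qm.
- by move=> u /jP.
Qed.

(** Otherwise there are new points with distinct first coordinates. A free generator lives on a
    single first coordinate, where at most one of these points lies, so it does not contain the set
    of them. *)
Lemma fst_bounded xi : exists S : seq K, forall d, D d ->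
  forall x, x \in pts (sup d xi) -> x.1 \in S.
Proof.
apply: contrapT => nS.
have [|f fP] := @seq_choice {ptws L -> words} (fun l d => D d /\ exists2 x, x \in pts (sup d xi) &
    forall d', d' \in l -> x.1 \notin map fst (pts (sup d' xi))).
  move=> l; apply: contrapT => h; apply: nS.
  exists (flatten [seq map fst (pts (sup d xi)) | d <- l]) => d Dd x xs; apply: contrapT => xl.
  apply: h; exists d; split=> //; exists x => // d' d'l; apply/negP => xd'.
  by apply: xl; apply/flattenP; eexists; [apply/mapP; exists d'|].
have fD n := proj1 (fP n); have /choice[x xP] : forall n, exists x, x \in pts (sup (f n) xi) /\
    forall d', d' \in mkseq f n -> x.1 \notin map fst (pts (sup d' xi)).
  by move=> n; have [x] := proj2 (fP n); exists x.
have xs n : x n \in pts (sup (f n) xi) by case: (xP n).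
have x1 m n : m < n -> (x n).1 \notin map fst (pts (sup (f m) xi)).
  by move=> mn; case: (xP n) => _; apply; exact: mem_mkseq_lt.
have xl m n : m < n -> x n \notin pts (sup (f m) xi).
  by move=> /x1; apply: contra; exact: map_f.
have x1i : injective (fun n => (x n).1).
  by apply: injective_of_lt => m n /x1 + e; rewrite -e map_f.
have [T [Tg TP]] := free_bounded xi.
apply: (@no_point_sequence xi T f) => //.
  by apply: injective_of_lt => m n /xl + e; rewrite e xs.
move=> t tg; exists 0, x; split=> // [m n _|u ul uf uR]; first exact: xl.
have ug : gens u by move: ul; rewrite mem_cat => /orP[/tg|/Tg[]].
have [e [i uE]] := gens_free ug uf; have uu := gens_ultra ug.
have ui : u [set w | w.1 = i] by rewrite uE; exact: lim_ultra_fst.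
have [w [[m _ xm] /= wi]] := ultra_disjoint uu uR ui.
apply: (uf (x m)); apply: (ultraS uu (ultraI uu uR ui)) => v [[n _ xn] /= vi].
have nm : n = m by apply: x1i; rewrite /= xn xm vi wi.
by rewrite /= -xn nm.
Qed.

(** [par_free] with empty [B], applied to the one-element lists from [zs], gives a new coordinate at
    each stage where all of [zs] vanish. *)
Lemma null_sequence (zs : seq (set (set X))) : (forall z, z \in zs -> gens z) ->
  exists2 a : nat -> MM, injective a & forall n z, z \in zs -> ~ z (phi (a n)).
Proof.
move=> zg.
have [|a aP] := @seq_choice MM (fun l a => a \notin l /\ forall z, z \in zs -> ~ z (phi a)).
  move=> l.
  have [||a al aP] := @par_free (fun n => take 1 (drop n zs)) set0 [set` l].
  - by move=> n z /mem_take/mem_drop/zg.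
  - by apply: finite_set_countable; exact: finite_seq.
  exists a; split; first exact/negP.
  move=> z zzs; have := aP (index z zs).
  have iz : index z zs < size zs by rewrite index_mem.
  rewrite (drop_nth z iz) nth_index //= take0 /par !big_seq1.
  have [_ z0 _ _ _] := gens_ultra (zg z zzs).
  by rewrite (asboolF z0) => /asboolP.
exists a; last by move=> n; case: (aP n).
apply: injective_of_lt => m n mn e; have [/negP + _] := aP n; apply.
by rewrite -e; exact: mem_mkseq_lt.
Qed.

(** * Many coordinates with points from the same finitely many sets X_i *)

Section FiniteFirstCoordinates.
Variables (S : seq K) (J : seq L).
Hypothesis J_uniq : uniq J.
Hypothesis J_size : 2 ^ size S < size J.
Hypothesis J_fst : forall xi, xi \in J -> forall d, D d ->
  forall x, x \in pts (sup d xi) -> x.1 \in S.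

Let w (d : {ptws L -> words}) : seq X := undup (flatten [seq pts (sup d xi) | xi <- J]).

Let fresh (P : seq X) (d : {ptws L -> words}) : seq X := [seq x <- w d | x \notin P].

Let mem_w d x : x \in w d <-> exists2 xi, xi \in J & x \in pts (sup d xi).
Proof.
rewrite mem_undup; split.
  by move=> /flattenP[s /mapP[xi xiJ ->] xs]; exists xi.
by move=> [xi xiJ xs]; apply/flattenP; exists (pts (sup d xi)) => //; apply/mapP; exists xi.
Qed.

Let w_bounded : exists k : nat, forall d, D d -> size (w d) <= k.
Proof.
suff [k kP] : exists k, forall d, D d -> size (flatten [seq pts (sup d xi) | xi <- J]) <= k.
  by exists k => d /kP; apply: leq_trans; exact: size_undup.
elim: J => [|xi l [k kP]]; first by exists 0.
have [k' kP'] := pts_bounded xi; exists (k' + k) => d Dd /=.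
by rewrite size_cat leq_add // ?kP' ?kP.
Qed.

Let free_list : exists T : seq (set (set X)), (forall z, z \in T -> gens z /\ free_ultra z) /\
  forall xi, xi \in J -> forall d, D d -> forall z, z \in sup d xi -> free_ultra z -> z \in T.
Proof.
have /choice[T TP] := free_bounded.
exists (flatten (map T J)); split.
  by move=> z /flattenP[_ /mapP[xi _ ->]]; case: (TP xi) => + _; apply.
move=> xi xiJ d Dd z zs zf; apply/flattenP; exists (T xi); first exact: map_f.
by case: (TP xi) => _; apply; [exact: Dd| |].
Qed.

(* If at most [size S] points of [w d] were outside [P], then two coordinates of [d] would have the same
   such points, hence the same value at every coordinate [a n] that vanishes on [P] and [T]. *)
Let fresh_large P : exists2 d, D d & size S < size (fresh P d).
Proof.
have [T [Tg TP]] := free_list.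
have [|a ai aP] := @null_sequence (map (@principal X) P ++ T).
  by move=> z; rewrite mem_cat => /orP[/mapP[x _ ->]|/Tg[]//]; exact: gens_principal.
(* The target point has, at each [xi] in [J], value 1 at [a (index xi J)] and 0 at the other listed
   [a n], so the elements of [J] are told apart. *)
have /choice[m mP] : forall xi, exists m, forall b, b \in mkseq a (size J) ->
    `[< phi b (k0, m) >] = (b == a (index xi J)).
  by move=> xi; exact: (phi_generic k0 (mkseq a (size J)) (fun b => b == a (index xi J))).
have [d Dd] := D_dense (fun xi => word (gens_principal (k0, m xi)))
  [seq (xi, b) | xi <- J, b <- mkseq a (size J)].
move=> /allP dag; exists d => //.
have dE xi eta : xi \in J -> eta \in J -> val (d xi) (a (index eta J)) = (eta == xi).
  move=> xiJ etaJ; have bJ : a (index eta J) \in mkseq a (size J).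
    by apply: mem_mkseq_lt; rewrite index_mem.
  have /eqP /= -> := dag (xi, a (index eta J)) (allpairs_f _ xiJ bJ).
  rewrite mP // (inj_eq ai); apply/eqP/eqP => [|-> //].
  by move=> e; rewrite -(nth_index xi etaJ) e nth_index.
rewrite ltnNge; apply/negP => small.
pose q := fresh P d.
(* There are at most [2 ^ size S] masks, fewer than elements of [J], so two elements have the same
   fresh points. *)
pose mask xi := [ffun k : 'I_(size q) => tnth (in_tuple q) k \in pts (sup d xi)].
have [|xi [eta [xiJ etaJ ne /ffunP mE]]] := @not_uniq_map _ _ mask J J_uniq.
  apply/negP => /card_uniqP; rewrite size_map => e.
  have := max_card (mem [seq mask xi | xi <- J]); rewrite e card_ffun card_bool card_ord.
  rewrite leqNgt => /negP; apply; apply: leq_ltn_trans J_size.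
  by rewrite leq_exp2l.
have pE th : th \in J -> val (d th) (a (index xi J)) =
    \big[addb/false]_(x <- [seq x <- pts (sup d th) | x \notin P]) `[< phi (a (index xi J)) x >].
  move=> thJ; rewrite suppE par_pts; last by move=> z /supp_ultra.
  rewrite [X in _ (+) X]big1_seq ?addbF; last first.
    move=> z /andP[/asboolP zf zs]; apply: asboolF; apply: aP.
    by rewrite mem_cat (TP th thJ d Dd) ?orbT.
  rewrite big_filter [RHS]big_mkcond /=; apply: eq_bigr => x _.
  case: ifP => // /negbFE xP; apply: asboolF.
  by apply: (aP _ (principal x)); rewrite mem_cat map_f.
have eqpts : perm_eq [seq x <- pts (sup d xi) | x \notin P]
                     [seq x <- pts (sup d eta) | x \notin P].
  have up th : uniq (pts (sup d th)) by exact/pts_uniq/supp_uniq.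
  apply: uniq_perm; rewrite ?filter_uniq // => x.
  rewrite !mem_filter; case: (boolP (x \in P)) => //= xP.
  suff : x \in q -> (x \in pts (sup d xi)) = (x \in pts (sup d eta)).
    move=> h; apply/idP/idP => xs.
      by rewrite -h // mem_filter xP; apply/mem_w; exists xi.
    by rewrite h // mem_filter xP; apply/mem_w; exists eta.
  move=> /(tnthP (in_tuple q))[k ->].
  by have := mE k; rewrite !ffunE.
have := dE xi xi xiJ xiJ; have := dE eta xi etaJ xiJ.
rewrite !pE // (perm_big _ eqpts) /= => ->.
by rewrite eqxx => /eqP.
Qed.

Let twins (P0 : seq X) (pr : L * L) (P : seq X) : Prop :=
  exists2 d, D d & (forall z, z \in fresh P0 d -> z \notin P) /\
    exists x y, [/\ x \in fresh P0 d, y \in fresh P0 d, x <> y, x.1 = y.1 &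
      x \in pts (sup d pr.1) /\ y \in pts (sup d pr.2)].

(* [P0] is the root of a Delta-system: by maximality of [s], new members [d] can be found with
   [fresh P0 d] disjoint from any prescribed finite set. *)
Let root : exists (P0 : seq X) (pr : L * L), pr.1 \in J /\ pr.2 \in J /\
  forall P, twins P0 pr P.
Proof.
(* A largest [s] with [Q s] exists by [w_bounded], and [P0] is a list outside which no [d] has more
   than [s] points. *)
pose Q s := forall P, exists2 d, D d & s <= size (fresh P d).
have [s [Ss Qs nQs]] : exists s, [/\ size S < s, Q s & ~ Q s.+1].
  apply: contrapT => h; have [k kP] := w_bounded.
  have QQ i : Q ((size S).+1 + i).
    elim: i => [|i IH]; first by rewrite addn0; exact: fresh_large.
    rewrite addnS; apply: contrapT => n; apply: h; exists ((size S).+1 + i); split=> //.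
    by rewrite leq_addr.
  have [d Dd] := QQ k [::]; rewrite leqNgt => /negP; apply.
  apply: (@leq_ltn_trans (size (w d))); first by rewrite size_filter count_size.
  by apply: (leq_ltn_trans (kP d Dd)); rewrite addSn ltnS leq_addl.
have [P0 P0s] : exists P0, forall d, D d -> size (fresh P0 d) <= s.
  apply: contrapT => h; apply: nQs => P; apply: contrapT => h'; apply: h; exists P => d Dd.
  by rewrite leqNgt; apply/negP => sd; apply: h'; exists d.
(* The pair of positions could vary with [P], but among finitely many pairs one serves all [P]. *)
have [|P|pr prJ prR] := @exists_forall_swap _ _ [seq (xi, eta) | xi <- J, eta <- J] (twins P0).
- move=> pr P P' PP' [d Dd [dP dxy]]; exists d => //; split=> // z /dP.
  by apply: contra; exact: PP'.
- have [d Dd ds] := Qs (P0 ++ P).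
  have fE : fresh (P0 ++ P) d = [seq x <- fresh P0 d | x \notin P].
    by rewrite -filter_predI; apply: eq_filter => x /=; rewrite mem_cat negb_or andbC.
  (* At most [s] points of [w d] are outside [P0], and at least [s] of these are outside [P], hence
     all are. *)
  have dP : all (fun x => x \notin P) (fresh P0 d).
    rewrite all_count eqn_leq count_size /= -size_filter -fE.
    exact: leq_trans (P0s d Dd) ds.
  (* More than [size S] fresh points have first coordinates in [S], so two share one. *)
  have [|x [y [xf yf xy xy1]]] := @not_uniq_map _ _ fst (fresh P0 d) (filter_uniq _ (undup_uniq _)).
    apply/negP => u1.
    have /(uniq_leq_size u1) : {subset map fst (fresh P0 d) <= S}.
      move=> k /mapP[x]; rewrite mem_filter => /andP[_ /mem_w[xi xiJ xs]] ->.
      exact: J_fst xiJ _ Dd _ xs.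
    rewrite size_map leqNgt => /negP; apply; apply: (leq_trans Ss); apply: (leq_trans ds).
    by rewrite fE size_filter count_size.
  have [xi xiJ xs] : exists2 xi, xi \in J & x \in pts (sup d xi).
    by apply/mem_w; move: xf; rewrite mem_filter => /andP[].
  have [eta etaJ ys] : exists2 xi, xi \in J & y \in pts (sup d xi).
    by apply/mem_w; move: yf; rewrite mem_filter => /andP[].
  exists (xi, eta); first exact: allpairs_f.
  by exists d => //; split; [exact/allP|exists x, y].
exists P0, pr; split; last split => //.
  by move/allpairsP: prJ => [[a b] [/= aJ bJ ->]].
by move/allpairsP: prJ => [[a b] [/= aJ bJ ->]].
Qed.

(** Two sequences [x] and [y] of new points, with [x n] and [y n] in the same X_i, have no
    ultrafilter in common after pulling back to indices. A set [N] separating the pullbacks yields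
    [B] and [B'] on which the accumulation point is even at [xi] and [eta], while each late term is
    odd on one of them. *)
Lemma finite_fst_absurd : False.
Proof.
have [P0 [[xi eta] /= [xiJ [etaJ rootP]]]] := root.
have [|f fP] := @seq_choice {ptws L -> words} (fun l d => D d /\
    (forall z, z \in fresh P0 d -> z \notin flatten (map w l)) /\
    exists xy : X * X, [/\ xy.1 \in fresh P0 d, xy.2 \in fresh P0 d, xy.1 <> xy.2, xy.1.1 = xy.2.1 &
      xy.1 \in pts (sup d xi) /\ xy.2 \in pts (sup d eta)]).
  move=> l; have [d Dd [dl [x [y [? ? ? ? [? ?]]]]]] := rootP (flatten (map w l)).
  by exists d; split=> //; split=> //; exists (x, y).
have fD n := proj1 (fP n).
have /choice[xy xyP] := fun n => proj2 (proj2 (fP n)).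
pose x n := (xy n).1; pose y n := (xy n).2.
have freshw n z : z \in fresh P0 (f n) -> z \in w (f n) by rewrite mem_filter => /andP[].
have fresh_lt m n z : m < n -> z \in fresh P0 (f n) -> z \notin w (f m).
  move=> mn zn; have [_ [/(_ z zn) + _]] := fP n; apply: contra => zw.
  by apply/flattenP; exists (w (f m)) => //; apply: map_f; exact: mem_mkseq_lt.
have fresh_neq k n z : z \in fresh P0 (f k) -> z \in w (f n) -> k = n.
  move=> zk zn; case: (ltngtP k n) => // lt; last by have := fresh_lt _ _ _ lt zk; rewrite zn.
  have zn' : z \in fresh P0 (f n) by move: zk; rewrite !mem_filter zn => /andP[-> _].
  by have := fresh_lt _ _ _ lt zn'; rewrite freshw.
have xf n : x n \in fresh P0 (f n) by case: (xyP n).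
have yf n : y n \in fresh P0 (f n) by case: (xyP n).
have xs n : x n \in pts (sup (f n) xi) by case: (xyP n) => _ _ _ _ [].
have ys n : y n \in pts (sup (f n) eta) by case: (xyP n) => _ _ _ _ [].
have xi_inj : injective x.
  by move=> k n e; apply: (fresh_neq k n (x k)) => //; rewrite e freshw.
have y_inj : injective y.
  by move=> k n e; apply: (fresh_neq k n (y k)) => //; rewrite e freshw.
have x_ne_y k n : x k <> y n.
  move=> e; have kn : k = n by apply: (fresh_neq k n (x k)) => //; rewrite e freshw.
  by subst k; case: (xyP n) => _ _ /(_ e).
have xy1 n : (x n).1 = (y n).1 by case: (xyP n).
have f_inj : injective f.
  by move=> k n e; apply: (fresh_neq k n (x k)) => //; rewrite -e freshw.
have wx k n : x k \in pts (sup (f n) xi) -> k = n.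
  by move=> h; apply: (fresh_neq k n (x k)) => //; apply/mem_w; exists xi.
have wy k n : y k \in pts (sup (f n) eta) -> k = n.
  by move=> h; apply: (fresh_neq k n (y k)) => //; apply/mem_w; exists eta.
have [p pP] := cluster_par f_inj fD.
have [T [Tg TP]] := free_list.
pose l1 := [seq u <- sup p xi ++ T | `[< free_ultra u /\ u (range x) >]].
pose l2 := [seq u <- sup p eta ++ T | `[< free_ultra u /\ u (range y) >]].
have lg th u : u \in sup p th ++ T -> gens u.
  by rewrite mem_cat => /orP[/supp_gens|/Tg[]].
have [||u' v'|N [N1 N2]] := @ultra_separate nat [seq [set N | u (x @` N)] | u <- l1]
    [seq [set N | u (y @` N)] | u <- l2].
- move=> _ /mapP[u + ->]; rewrite mem_filter => /andP[/asboolP[uf ur] /lg/gens_ultra uu].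
  exact: ultra_preimage.
- move=> _ /mapP[u + ->]; rewrite mem_filter => /andP[/asboolP[uf ur] /lg/gens_ultra uu].
  exact: ultra_preimage.
- move=> /mapP[u + ->] /mapP[v + ->]; rewrite !mem_filter.
  move=> /andP[/asboolP[uf ur] ul] /andP[/asboolP[vf vr] vl].
  by apply: lim_ultra_pullback_neq => //; [exact: lg ul|exact: lg vl].
have [n1 n1P] := injective_avoid_seq (pts (sup p xi)) xi_inj.
have [n2 n2P] := injective_avoid_seq (pts (sup p eta)) y_inj.
pose n0 := maxn n1 n2.
(* Pullbacks along [x] contain [N] and those along [y] do not, so no free ultrafilter in question
   contains [B], respectively [B']. Starting at [n0] keeps out the points in the support of [p]. *)
pose B := x @` [set n | n0 <= n /\ ~ N n]; pose B' := y @` [set n | n0 <= n /\ N n].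
have Bfree u : u \in sup p xi ++ T -> free_ultra u -> ~ u B.
  move=> ul uf uB; have uu := gens_ultra (lg _ _ ul).
  have ur : u (range x) by apply: (ultraS uu uB) => v [n _ <-]; exists n.
  have uN : u (x @` N).
    apply: (N1 [set N | u (x @` N)]); apply/mapP; exists u => //.
    by rewrite mem_filter ul andbT; exact/asboolP.
  have [v [[n [_ nN] <-] [m Nm /xi_inj mn]]] := ultra_disjoint uu uB uN.
  by apply: nN; rewrite -mn.
have B'free u : u \in sup p eta ++ T -> free_ultra u -> ~ u B'.
  move=> ul uf uB; have uu := gens_ultra (lg _ _ ul).
  have ur : u (range y) by apply: (ultraS uu uB) => v [n _ <-]; exists n.
  apply: (N2 [set N | u (y @` N)]).
    by apply/mapP; exists u => //; rewrite mem_filter ul andbT; exact/asboolP.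
  by apply: (ultraS uu uB) => v [n [_ Nn] <-]; exists n.
have [n nn0 [eB eB']] := pP xi eta B B' n0.
have pB : par (sup p xi) B = false.
  apply: par_eq0 => z zs zB; case: (ultra_cases (supp_ultra zs)) => [zf|[v zv]].
    by apply: (Bfree z) => //; rewrite mem_cat zs.
  subst z; case: zB => k [/= nk _] kv; have := n1P k (leq_trans (leq_maxl _ _) nk).
  by rewrite kv mem_pts zs.
have pB' : par (sup p eta) B' = false.
  apply: par_eq0 => z zs zB; case: (ultra_cases (supp_ultra zs)) => [zf|[v zv]].
    by apply: (B'free z) => //; rewrite mem_cat zs.
  subst z; case: zB => k [/= nk _] kv; have := n2P k (leq_trans (leq_maxr _ _) nk).
  by rewrite kv mem_pts zs.
rewrite pB in eB; rewrite pB' in eB'.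
have [Nn|Nn] := pselect (N n).
  suff : par (sup (f n) eta) B' by rewrite eB'.
  apply: (@par1 _ _ (principal (y n))); first exact: supp_uniq.
  - by rewrite -mem_pts.
  - by exists n.
  move=> z zs zy zB; case: (ultra_cases (supp_ultra zs)) => [zf|[v zv]].
    by apply: (B'free z) => //; rewrite mem_cat (TP eta etaJ (f n)) ?orbT.
  subst z; case: zB => k _ kv; apply: zy; rewrite -kv; congr (principal (y _)).
  by apply: wy; rewrite kv mem_pts.
suff : par (sup (f n) xi) B by rewrite eB.
apply: (@par1 _ _ (principal (x n))); first exact: supp_uniq.
- by rewrite -mem_pts.
- by exists n.
move=> z zs zy zB; case: (ultra_cases (supp_ultra zs)) => [zf|[v zv]].
  by apply: (Bfree z) => //; rewrite mem_cat (TP xi xiJ (f n)) ?orbT.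
subst z; case: zB => k _ kv; apply: zy; rewrite -kv; congr (principal (x _)).
by apply: wx; rewrite kv mem_pts.
Qed.

End FiniteFirstCoordinates.

End Accumulation.

(** [fst_bounded] assigns a finite list over [K] to each element of [L]. As [L] does not embed in
    [K], infinitely many share one list [s], and [2 ^ size s + 1] of them suffice. *)
Lemma words_power_not_countably_pracompact (L : choiceType) : infinite_set [set: K] ->
  ~ embeds L K -> ~ countably_pracompact {ptws L -> words}.
Proof.
move=> Kinf LK [D [/dense_agreeP Dd Dacc]].
have [k0 _] := infinite_setN0 Kinf.
have acc (f : nat -> {ptws L -> words}) : injective f -> (forall n, D (f n)) ->
    exists p : {ptws L -> words}, forall l n0, exists2 n, n0 <= n & agree p (f n) l.
  move=> fi fD; have [||p fp] := Dacc (range f).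
  - by move=> _ [n _ <-].
  - apply: contra_not infinite_nat => h.
    by rewrite -(eq_finite_set (@inj_card_eq _ _ setT f _)) // => n m _ _ /fi.
  by exists p; exact: limit_point_seq.
have /choice[S SP] := fst_bounded acc.
have [s sinf] := infinite_fiber S Kinf LK.
have [J [Ju Js JP]] := infinite_uniq_seq (2 ^ size s).+1 sinf.
apply: (@finite_fst_absurd k0 L D Dd acc s J Ju).
  by rewrite Js.
by move=> xi /JP/= <- d; exact: SP.
Qed.

End Words.

Theorem mainTheorem13 :
  (exists U : set (set nat) -> set (set nat),
      (forall i, selective (U i)) /\
      (forall i j, i <> j -> RK_incomparable (U i) (U j))) ->
  forall K : Type,
    infinite_set [set: K] ->
    [set: K] #<= [set: set (set nat)] ->
    exists (G : topologicalType) (mul : G -> G -> G) (inv : G -> G) (e : G),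
      [/\ topological_group mul inv e, hausdorff_space G,
          countably_pracompact {ptws K -> G} &
          forall K' : Type, is_successor_card K K' ->
            ~ countably_pracompact {ptws K' -> G}].
Proof.
move=> [U [Usel Uinc]] K Kinf /card_le_embeds KM.
have [phi [phi_free phi_gen]] := @generic_sets {classic K} KM.
have idM : embeds MM MM by exists id.
(* There are at most $2^{\mathfrak c}$ sequences of finite lists, so the index set of the
   ultrafilters enumerates them all. *)
have [i [l il]] : exists (i : (nat -> seq ({classic K} * MM)) -> MM) l, cancel i l.
  apply: embeds_retract; last exact: (inhabits (fun=> [::])).
  by apply: embeds_big_seqfun; apply: embeds_big_seq; exact: embeds_big_pair.
pose F e n k := lookup set0 (l e n) k.
exists (words phi U F), (cube_add (@wordsD _ phi U F)), id, (cube0 (words0 phi U F)); split.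
- exact: cube_topological_group.
- exact: cube_hausdorff.
- apply: (@words_power_countably_pracompact {classic K}) => // s.
  by exists (i s) => n k; rewrite /F il.
move=> K' [_ [K'K _]].
apply: (@words_power_not_countably_pracompact {classic K} phi U F _ _ _ _ {classic K'}) => //.
by move/card_le_embeds.
Qed.
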